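(* Let $\Gamma=(V,E)$ be a layered graph with unique minimal vertex $*$. Then $\operatorname{gr}A(\Gamma)\cong T(V_+)/R_{gr}$, where $R_{gr}$ is the two-sided ideal of $T(V_+)$ generated by all elements $v_0v_1\cdots v_n-w_0w_1\cdots w_n$ with $(v_0,\dots,v_n)$ and $(w_0,\dots,w_n)$ vertex paths consisting of vertices of $V_+$ and with $v_0=w_0$.
   Context: A layered graph is a finite directed graph $\Gamma=(V,E)$ with $V=\bigsqcup_{i=0}^{N}V_i$ such that every edge from $V_i$ goes to $V_{i-1}$; $|v|=i$ for $v\in V_i$, $V_+=\bigsqcup_{i\ge1}V_i$, every vertex of $V_+$ has at least one outgoing edge, and $V_0=\{*\}$. A vertex path is a sequence $(v_0,\dots,v_n)$ with $(v_{j},v_{j+1})\in E$ for all $j$. The universal labeling algebra $A(\Gamma)$ is $T(E)/R$, where $T(E)$ is the free algebra over a field $\mathbb F$ and $R$ is generated by the differences of the coefficients of $(t-e_1)\cdots(t-e_m)$ and $(t-f_1)\cdots(t-f_m)$ ($t$ central) over all pairs of edge paths with the same start and same end; equivalently $A(\Gamma)\cong T(V_+)/R_V$ via $(v,w)\mapsto v-w$ ($w\ne *$), $(v,* )\mapsto v$. $\operatorname{gr}A(\Gamma)$ denotes the associated graded algebra of $A(\Gamma)=T(V_+)/R_V$ with respect to the vertex filtration, in which the image of a monomial $v_1\cdots v_j$ has filtration degree $\sum_k|v_k|$. *)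

(* Defs.v *)
From HB Require Import structures.
From mathcomp Require Import all_boot all_order all_algebra.
From Stdlib Require List.
Set Implicit Arguments. Unset Strict Implicit. Unset Printing Implicit Defensive.
Import GRing.Theory.
Local Open Scope ring_scope.

Definition layered (V : finType) (E : rel V) (lvl : V -> nat) (star : V) : Prop :=
  [/\ (forall v w, E v w -> lvl v = (lvl w).+1),
      (forall v, lvl v = 0%N <-> v = star) &
      (forall v, (0 < lvl v)%N -> exists w, E v w)].

Section FreeAlg.
Variables (F : fieldType) (V : finType) (E : rel V) (lvl : V -> nat).

Definition Vp := {v : V | (0 < lvl v)%N}.

(* Elements of the free algebra T(V_+) are represented by formal finite
   linear combinations of words over V_+; two representatives denote the
   same element iff all their coefficients agree (teq). *)
Definition word := seq Vp.
Definition Tel := seq (F * word).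

Definition coef (x : Tel) (w : word) : F :=
  \sum_(p <- x) (if p.2 == w then p.1 else 0).
Definition teq (x y : Tel) : Prop := forall w, coef x w = coef y w.

Definition tzero : Tel := [::].
Definition tone : Tel := [:: (1, [::])].
Definition tword (w : word) : Tel := [:: (1, w)].
Definition tadd (x y : Tel) : Tel := x ++ y.
Definition tscale (c : F) (x : Tel) : Tel := [seq (c * p.1, p.2) | p <- x].
Definition topp (x : Tel) : Tel := tscale (-1) x.
Definition tsub (x y : Tel) : Tel := tadd x (topp y).
Definition tmul (x y : Tel) : Tel :=
  [seq (p.1 * q.1, p.2 ++ q.2) | p <- x, q <- y].
Definition tsum (l : seq Tel) : Tel := foldr tadd tzero l.

Definition in_ideal (S : Tel -> Prop) (x : Tel) : Prop :=
  exists l : seq (Tel * Tel * Tel),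
    (forall t, List.In t l -> S t.1.2) /\
    teq x (tsum [seq tmul (tmul t.1.1 t.1.2) t.2 | t <- l]).

(* image of the edge (a,b) in T(V_+):  a - b  if b <> *,  a  if b = * *)
Definition edge_img (ab : V * V) : Tel :=
  match insub ab.1 : option Vp, insub ab.2 : option Vp with
  | Some a, Some b => [:: (1, [:: a]); (-1, [:: b])]
  | Some a, None => [:: (1, [:: a])]
  | None, _ => tzero
  end.

(* polynomials in a central variable t with coefficients in T(V_+):
   P = [:: P_0; P_1; ...] stands for sum_j P_j t^j *)
Definition lin_mul (x : Tel) (P : seq Tel) : seq Tel :=
  [seq tsub (nth tzero (tzero :: P) j) (tmul x (nth tzero P j))
  | j <- iota 0 (size P).+1].
(* (t - x_1)(t - x_2)...(t - x_m) *)
Definition prod_lin (l : seq Tel) : seq Tel := foldr lin_mul [:: tone] l.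

Definition path_edges (v : V) (s : seq V) : seq (V * V) := zip (v :: s) s.

(* generators of R_V: differences of the coefficients of
   (t - e_1)...(t - e_m) and (t - f_1)...(t - f_m) for two edge paths with
   the same start and the same end, transported to T(V_+). *)
Definition RV_gen (x : Tel) : Prop :=
  exists (v : V) (s1 s2 : seq V) (j : nat),
    [/\ path E v s1, path E v s2, last v s1 = last v s2 &
      x = tsub (nth tzero (prod_lin [seq edge_img e | e <- path_edges v s1]) j)
               (nth tzero (prod_lin [seq edge_img e | e <- path_edges v s2]) j)].

Definition RV (x : Tel) : Prop := in_ideal RV_gen x.

Definition Ep (a b : Vp) : bool := E (val a) (val b).

Definition Rgr_gen (x : Tel) : Prop :=
  exists (v : Vp) (s1 s2 : seq Vp),
    [/\ size s1 = size s2, path Ep v s1, path Ep v s2 &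
      x = tsub (tword (v :: s1)) (tword (v :: s2))].

Definition Rgr (x : Tel) : Prop := in_ideal Rgr_gen x.

Definition weight (w : word) : nat := (\sum_(v <- w) lvl (val v))%N.

Definition inF (i : nat) (x : Tel) : Prop :=
  forall w, (i < weight w)%N -> coef x w = 0.
(* x lies in F_{i-1} T(V_+)  (F_{-1} = 0) *)
Definition inFlt (i : nat) (x : Tel) : Prop :=
  forall w, (i <= weight w)%N -> coef x w = 0.

(* An element of gr A = (+)_i F_i A / F_{i-1} A, where F_i A = (F_i T + R_V)/R_V,
   is represented by a finite family a = [:: a_0; a_1; ...] with a_i in F_i T;
   the i-th component is the class of a_i in
   gr_i A = (F_i T + R_V) / (F_{i-1} T + R_V). *)
Definition gr_valid (a : seq Tel) : Prop := forall i, inF i (nth tzero a i).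

Definition gr_eq (a b : seq Tel) : Prop :=
  forall i, exists y r, inFlt i y /\ RV r /\
    teq (tsub (nth tzero a i) (nth tzero b i)) (tadd y r).

Definition gr_add (a b : seq Tel) : seq Tel :=
  mkseq (fun i => tadd (nth tzero a i) (nth tzero b i)) (maxn (size a) (size b)).
Definition gr_scale (c : F) (a : seq Tel) : seq Tel := [seq tscale c x | x <- a].
Definition gr_mul (a b : seq Tel) : seq Tel :=
  mkseq (fun k => tsum [seq tmul (nth tzero a i) (nth tzero b (k - i))
                       | i <- iota 0 k.+1]) (size a + size b).
Definition gr_one : seq Tel := [:: tone].

Definition gr_iso_Rgr : Prop :=
  exists phi : seq Tel -> Tel,
    [/\
        (forall a b, gr_valid a -> gr_valid b ->
           (gr_eq a b <-> Rgr (tsub (phi a) (phi b)))),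
        (forall x, exists a, gr_valid a /\ Rgr (tsub (phi a) x)),
        (forall a b, gr_valid a -> gr_valid b ->
           Rgr (tsub (phi (gr_add a b)) (tadd (phi a) (phi b)))),
        (forall c a, gr_valid a ->
           Rgr (tsub (phi (gr_scale c a)) (tscale c (phi a)))) &
        ((forall a b, gr_valid a -> gr_valid b ->
           Rgr (tsub (phi (gr_mul a b)) (tmul (phi a) (phi b))))
        /\ Rgr (tsub (phi gr_one) tone))].

End FreeAlg.

(* Main.v *)
(** Write e(v,k) for the k-th coefficient, up to sign, of the product of the
    (t - e_i) along an edge path from v to the bottom vertex, and put
    P_v(s) = sum_k e(v,k) s^k. In these variables A(Gamma) is defined by
    requiring, for each edge v -> w, that the power series P_v P_w^-1 is a
    polynomial of degree one.

    The free algebra on the symbols e(v,k) acts from the right on the vector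
    space spanned by the normal words, those without a factor e(u,j) e(v,k) for
    which a path of length j leads from u to v; products with such a factor are
    rewritten by P_u = C P_v with C = P_u P_v^-1 truncated at degree j.
    Factoring P_z P_v^-1 = (P_z P_u^-1)(P_u P_v^-1) gives, by induction on the
    weight of the word acted upon, that P_u P_v^-1 acts as a polynomial; hence
    R_V acts as zero. In top weight the action on the empty word reduces words
    modulo R_gr to normal form, so leading forms of elements of R_V lie in R_gr.
    Conversely v_0 ... v_n - w_0 ... w_n with v_0 = w_0 is, up to sign, the
    leading form of the difference of the coefficients of t^(N-n-1), N = |v_0|,
    of two full paths from v_0. The isomorphism sends a family of
    representatives to the sum of their leading forms. *)

From HB Require Import structures.
Require Import Defs.
From mathcomp Require Import all_boot all_order all_algebra finmap.
From mathcomp Require Import monalg zify.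

Set Implicit Arguments. Unset Strict Implicit. Unset Printing Implicit Defensive.
Import GRing.Theory.
Local Open Scope ring_scope.

(** * Power series *)

Section Convolution.
Variable R : nzRingType.
Implicit Types f g h : nat -> R.

Definition conv f g n : R := \sum_(i < n.+1) f i * g (n - i)%N.

Lemma conv_polyE f g n N : (n < N)%N ->
  conv f g n = ((\poly_(i < N) f i) * (\poly_(i < N) g i))`_n.
Proof.
move=> nN; rewrite coefM; apply: eq_bigr => i _; rewrite !coef_poly.
have lt_i := ltn_ord i; rewrite (_ : (i < N)%N); last by lia.
by rewrite (_ : (n - i < N)%N) //; lia.
Qed.

Lemma eq_conv f f' g g' n :
  (forall i, (i <= n)%N -> f i = f' i) -> (forall i, (i <= n)%N -> g i = g' i) ->
  conv f g n = conv f' g' n.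
Proof.
move=> ff gg; apply: eq_bigr => i _; rewrite ff ?gg ?leq_subr //.
by rewrite -ltnS.
Qed.

(** The coefficient of index [n] involves only terms of index at most [n], so associativity is
    inherited from the product of the truncated polynomials. *)
Lemma convA f g h n : conv f (conv g h) n = conv (conv f g) h n.
Proof.
pose P (k : nat -> R) := \poly_(i < n.+1) k i.
have PE k (i : nat) : (i <= n)%N -> k i = (P k)`_i.
  by rewrite -ltnS coef_poly => ->.
rewrite (@eq_conv f (fun i => (P f)`_i) _ (fun i => (P g * P h)`_i)); last 2 first.
- exact: PE.
- by move=> i ?; apply: conv_polyE.
rewrite (@eq_conv (conv f g) (fun i => (P f * P g)`_i) _ (fun i => (P h)`_i)).
- by rewrite /conv -!coefM mulrA.
- by move=> i ?; apply: conv_polyE.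
exact: PE.
Qed.

Lemma conv_recr f g n : g 0%N = 1 ->
  conv f g n = (\sum_(i < n) f i * g (n - i)%N) + f n.
Proof. by move=> g0; rewrite /conv big_ord_recr /= subnn g0 mulr1. Qed.

(* [rdiv f g] is the coefficient sequence of the power series [f * g^-1]. *)
Fixpoint rdivs f g n : seq R :=
  if n is n'.+1 then
    let s := rdivs f g n' in
    rcons s (f n' - \sum_(i < n') s`_i * g (n' - i)%N)
  else [::].

Definition rdiv f g n : R := (rdivs f g n.+1)`_n.

Lemma size_rdivs f g n : size (rdivs f g n) = n.
Proof. by elim: n => //= n IH; rewrite size_rcons IH. Qed.

Lemma nth_rdivs f g n i : (i < n)%N -> (rdivs f g n)`_i = rdiv f g i.
Proof.
elim: n => // n IH; rewrite ltnS leq_eqVlt => /orP[/eqP-> //|lt_in].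
by rewrite [rdivs _ _ _]/= nth_rcons size_rdivs lt_in IH.
Qed.

Lemma rdivE f g n :
  rdiv f g n = f n - \sum_(i < n) rdiv f g i * g (n - i)%N.
Proof.
rewrite {1}/rdiv [rdivs _ _ _]/= nth_rcons size_rdivs ltnn eqxx.
by congr (_ - _); apply: eq_bigr => i _; rewrite nth_rdivs.
Qed.

Lemma rdivK f g n : g 0%N = 1 -> conv (rdiv f g) g n = f n.
Proof. by move=> g0; rewrite conv_recr // [X in _ + X]rdivE addrC subrK. Qed.

Lemma conv_inj f f' g : g 0%N = 1 ->
  (forall n, conv f g n = conv f' g n) -> forall n, f n = f' n.
Proof.
move=> g0 eqc; elim/ltn_ind => n IH.
have := eqc n; rewrite !conv_recr //.
rewrite (eq_bigr (fun i : 'I_n => f' i * g (n - i)%N)); first exact: addrI.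
by move=> i _; rewrite IH.
Qed.

(** This is f h^-1 = (f g^-1)(g h^-1): multiplying either side by [h] on the right gives [f], and
    [h] cancels because its constant term is 1. *)
Lemma rdiv_conv f g h n : g 0%N = 1 -> h 0%N = 1 ->
  rdiv f h n = conv (rdiv f g) (rdiv g h) n.
Proof.
move=> g0 h0; move: n; apply: (conv_inj h0) => n.
rewrite rdivK // -convA (@eq_conv _ (rdiv f g) _ g) ?rdivK // => i _.
exact: rdivK.
Qed.

Lemma rdiv0 f g : rdiv f g 0 = f 0%N.
Proof. by rewrite rdivE big_ord0 subr0. Qed.

(** Isolates the terms with a left factor of index 0 or 1. For an edge v -> w and f = P_v P_w^-1,
    the remaining terms will act as zero. *)
Lemma conv_split2 f g k : f 0%N = 1 ->
  conv f g k.+1 - (g k.+1 + f 1%N * g k) = \sum_(i < k) f i.+2 * g (k - i.+1)%N.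
Proof.
move=> f0; rewrite /conv big_ord_recl big_ord_recl /= f0 mul1r subn0 subn1 /= addrA.
rewrite -[f (bump 0 0)]/(f 1%N) [LHS]addrAC subrr add0r.
by apply: eq_bigr => i _; rewrite /bump /= !add1n subSS.
Qed.

End Convolution.

(** Evaluation at the central point 1 turns a product of polynomials into the product of their
    coefficient sums. It makes the sum of leading forms multiplicative. *)
Lemma sum_convolution (R : nzRingType) (f g : nat -> R) m n :
  (forall i, (m <= i)%N -> f i = 0) -> (forall j, (n <= j)%N -> g j = 0) ->
  \sum_(k < m + n) \sum_(i < k.+1) f i * g (k - i)%N =
  (\sum_(i < m) f i) * (\sum_(j < n) g j).
Proof.
move=> f0 g0; pose P := \poly_(i < m) f i; pose Q := \poly_(i < n) g i.
have PE i : P`_i = f i by rewrite coef_poly; case: ltnP => // /f0.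
have QE i : Q`_i = g i by rewrite coef_poly; case: ltnP => // /g0.
have sP : (size P <= m)%N by apply: size_poly.
have sQ : (size Q <= n)%N by apply: size_poly.
have sPQ : (size (P * Q)%R <= m + n)%N.
  apply: leq_trans (size_polyMleq _ _) _; apply: leq_trans (leq_pred _) _.
  exact: leq_add.
transitivity ((P * Q).[1]).
  rewrite (horner_coef_wide _ sPQ); apply: eq_bigr => k _.
  by rewrite expr1n mulr1 coefM; apply: eq_bigr => i _; rewrite PE QE.
rewrite hornerM_comm; last by rewrite /comm_poly mulr1 mul1r.
rewrite (horner_coef_wide _ sP) (horner_coef_wide _ sQ).
by congr (_ * _); apply: eq_bigr => i _; rewrite ?PE ?QE expr1n mulr1.
Qed.

Lemma pmap_insub_val (T : Type) (P : pred T) (sT : subType P) (s : seq sT) :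
  pmap (insub : T -> option sT) [seq val x | x <- s] = s.
Proof. by elim: s => //= x s IH; rewrite valK /= IH. Qed.

Lemma mul_split (R : nzRingType) (u u' v v' : R) :
  u * v = (u - u') * v + (u' * (v - v') + u' * v').
Proof. by rewrite -mulrDr subrK -mulrDl subrK. Qed.

Lemma additive_split (U U' : zmodType) (f : U -> U') a b c d :
  {morph f : x y / x + y} -> f a = 0 -> f b = 0 -> f c = d -> f (a + (b + c)) = d.
Proof. by move=> fD fa fb fc; rewrite !fD fa fb fc !add0r. Qed.

(** Holds because s squared is 1. It expresses a difference of two words through the errors of two
    leading terms and the difference of the two coefficients. *)
Lemma signed_cancel (F : fieldType) (L : lmodType F) k (c1 c2 m1 m2 : L) :
  let s : F := (-1) ^+ k in
  s *: ((c2 - s *: m2) - (c1 - s *: m1)) + s *: (c1 - c2) = m1 - m2.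
Proof.
move=> s; rewrite -scalerDr opprB -addrA [_ - c1 + _]addrA subrK addrC addrA subrK.
by rewrite -scalerBr scalerA -expr2 sqrr_sign scale1r.
Qed.

(** * Free modules and free algebras *)

Section Basis.
Context {F : fieldType} {K : choiceType}.

(* Sealed: failing unifications of two basis elements would otherwise unfold
   the finite-support representation. *)
Fact bas_seal : {f : K -> {malg F[K]} | f = fun k => << k >>}.
Proof. by eexists. Qed.
Definition bas : K -> {malg F[K]} := sval bas_seal.

Lemma basE k : bas k = << k >>.
Proof. by rewrite /bas (svalP bas_seal). Qed.

Lemma mcoeff_bas k k' : (bas k)@_k' = (k == k')%:R.
Proof. by rewrite basE mcoeffU. Qed.

Lemma bas_scale c k : << c *g k >> = c *: bas k.
Proof.
by apply/malgP => k'; rewrite mcoeffZ mcoeff_bas mcoeffU mulr_natr.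
Qed.

End Basis.

Section LinearExtension.
Variables (F : fieldType) (K : choiceType).
Local Notation M := {malg F[K]}.

Fact lext_seal (X : lmodType F) : {e : (K -> X) -> M -> X |
  e = fun f u => \sum_(k <- msupp u) u@_k *: f k}.
Proof. by eexists. Qed.
Definition lext (X : lmodType F) : (K -> X) -> M -> X := sval (lext_seal X).

Lemma lextE (X : lmodType F) (f : K -> X) (u : M) :
  lext f u = \sum_(k <- msupp u) u@_k *: f k.
Proof. by rewrite /lext (svalP (lext_seal X)). Qed.

Lemma lextEw (X : lmodType F) (f : K -> X) (u : M) (d : {fset K}) :
  (msupp u `<=` d)%fset -> lext f u = \sum_(k <- d) u@_k *: f k.
Proof.
move=> le_ud; rewrite lextE (big_fset_incl _ le_ud) // => k _.
by move/mcoeff_outdom->; rewrite scale0r.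
Qed.

Lemma lext_is_linear (X : lmodType F) (f : K -> X) : linear (lext f).
Proof.
move=> a u v; pose d := (msupp u `|` msupp v)%fset.
rewrite (@lextEw _ _ u d) ?fsubsetUl // (@lextEw _ _ v d) ?fsubsetUr //.
rewrite (@lextEw _ _ _ d); last first.
  apply/fsubsetP => k; rewrite -mcoeff_neq0 mcoeffD mcoeffZ => nz.
  rewrite in_fsetU -!mcoeff_neq0; apply: contraNT nz.
  by rewrite negb_or !negbK => /andP[/eqP-> /eqP->]; rewrite mulr0 addr0.
rewrite scaler_sumr -big_split /=; apply: eq_bigr => k _.
by rewrite mcoeffD mcoeffZ scalerDl scalerA.
Qed.

HB.instance Definition _ (X : lmodType F) (f : K -> X) :=
  GRing.isLinear.Build F M X *:%R (lext f) (lext_is_linear f).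

Lemma lext_bas (X : lmodType F) (f : K -> X) k : lext f (bas k) = f k.
Proof.
by rewrite basE lextE msuppU oner_eq0 big_seq_fset1 mcoeffUU scale1r.
Qed.

Lemma eq_lext (X : lmodType F) (f g : K -> X) (u : M) :
  (forall k, u@_k != 0 -> f k = g k) -> lext f u = lext g u.
Proof.
move=> fg; rewrite !lextE !big_seq; apply: eq_bigr => k.
by rewrite -mcoeff_neq0 => /fg->.
Qed.

Lemma malg_lextE (u : M) : u = lext bas u.
Proof.
by rewrite {1}[u]monalgE lextE; apply: eq_bigr => k _; rewrite bas_scale.
Qed.

Lemma linear_lext (X Y : lmodType F) (h : {linear X -> Y}) (f : K -> X) (u : M) :
  h (lext f u) = lext (fun k => h (f k)) u.
Proof.
by rewrite !lextE linear_sum; apply: eq_bigr => k _; rewrite linearZ.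
Qed.

Lemma lextB (X : lmodType F) (f g : K -> X) (u : M) :
  lext f u - lext g u = lext (fun k => f k - g k) u.
Proof.
by rewrite !lextE -sumrB; apply: eq_bigr => k _; rewrite scalerBr.
Qed.

Lemma lext_eq0 (X : lmodType F) (f : K -> X) (u : M) :
  (forall k, u@_k != 0 -> f k = 0) -> lext f u = 0.
Proof.
move=> f0; rewrite lextE big_seq big1 // => k; rewrite -mcoeff_neq0 => /f0->.
by rewrite scaler0.
Qed.

End LinearExtension.

(** * Weight filtrations on free modules *)

Section Bounded.
Variables (F : fieldType) (K : choiceType) (wt : K -> nat).
Implicit Types u v : {malg F[K]}.

Definition bounded n u := forall k, (n < wt k)%N -> u@_k = 0.

Lemma boundedW n n' u : (n <= n')%N -> bounded n u -> bounded n' u.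
Proof. by move=> le_n bu k lt; apply: bu; apply: leq_ltn_trans lt. Qed.

Lemma bounded0 n : bounded n 0.
Proof. by move=> k _; rewrite mcoeff0. Qed.

Lemma boundedD n u v : bounded n u -> bounded n v -> bounded n (u + v).
Proof. by move=> bu bv k lt; rewrite mcoeffD bu ?bv ?addr0. Qed.

Lemma boundedZ n c u : bounded n u -> bounded n (c *: u).
Proof. by move=> bu k lt; rewrite mcoeffZ bu ?mulr0. Qed.

Lemma boundedB n u v : bounded n u -> bounded n v -> bounded n (u - v).
Proof. by move=> bu bv k lt; rewrite mcoeffB bu ?bv ?subr0. Qed.

Lemma bounded_sum n (I : Type) (r : seq I) (P : pred I) (f : I -> {malg F[K]}) :
  (forall i, P i -> bounded n (f i)) -> bounded n (\sum_(i <- r | P i) f i).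
Proof. by move=> bf; elim/big_ind: _ => //; [apply: bounded0 | apply: boundedD]. Qed.

Lemma bounded_bas n k : (wt k <= n)%N -> bounded n (bas k).
Proof.
move=> le k' lt; rewrite mcoeff_bas; case: eqP => // kk.
by move: lt; rewrite -kk ltnNge le.
Qed.

Lemma bounded_mem n u k : bounded n u -> u@_k != 0 -> (wt k <= n)%N.
Proof. by move=> bu nz; rewrite leqNgt; apply: contraNN nz => /bu->. Qed.

End Bounded.

Section Below.
Variables (F : fieldType) (K : choiceType) (wt : K -> nat).
Implicit Types u v : {malg F[K]}.

(** The strict filtration step is kept separate from [bounded] so that index 0 stands for F_{-1} =
    0. *)
Definition below n u := forall k, (n <= wt k)%N -> u@_k = 0.

Lemma below0 n : below n 0.
Proof. by move=> k _; rewrite mcoeff0. Qed.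

Lemma belowD n u v : below n u -> below n v -> below n (u + v).
Proof. by move=> bu bv k le; rewrite mcoeffD bu ?bv ?addr0. Qed.

Lemma belowB n u v : below n u -> below n v -> below n (u - v).
Proof. by move=> bu bv k le; rewrite mcoeffB bu ?bv ?subr0. Qed.

Lemma belowZ n c u : below n u -> below n (c *: u).
Proof. by move=> bu k le; rewrite mcoeffZ bu ?mulr0. Qed.

Lemma below_sum n (I : Type) (r : seq I) (P : pred I) (f : I -> {malg F[K]}) :
  (forall i, P i -> below n (f i)) -> below n (\sum_(i <- r | P i) f i).
Proof. by move=> bf; elim/big_ind: _ => //; [apply: below0 | apply: belowD]. Qed.

Lemma bounded_below n n' u : (n < n')%N -> bounded wt n u -> below n' u.
Proof. by move=> lt bu k le; apply: bu; apply: leq_trans lt le. Qed.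

Lemma below_bounded n u : below n u -> bounded wt n u.
Proof. by move=> bu k /ltnW; apply: bu. Qed.

Lemma belowP n u : below n u -> u = 0 \/ (exists2 m, n = m.+1 & bounded wt m u).
Proof.
case: n => [|n] bu; last by right; exists n.
by left; apply/malgP => k; rewrite mcoeff0 bu.
Qed.

End Below.

Lemma bounded_lext (F : fieldType) (K K' : choiceType) (wt : K -> nat)
    (wt' : K' -> nat) n n' (f : K -> {malg F[K']}) u :
  bounded wt n u -> (forall k, (wt k <= n)%N -> bounded wt' n' (f k)) ->
  bounded wt' n' (lext f u).
Proof.
move=> bu bf; rewrite lextE big_seq; apply: bounded_sum => k.
rewrite -mcoeff_neq0 => nz; apply: boundedZ; apply: bf.
exact: bounded_mem nz.
Qed.

(** * Weights of words in a free algebra *)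

Definition wwt (K : Type) (wt : K -> nat) (s : seq K) : nat := (\sum_(k <- s) wt k)%N.

Section FreeAlgebra.
Variables (F : fieldType) (K : choiceType).
Local Notation A := {malg F[{fmonom K}]}.

Definition mon (s : seq K) : A := bas (FMonom s).

Lemma monM s t : mon s * mon t = mon (s ++ t).
Proof.
by rewrite malgM_def /mon !basE fgmulUU mulr1 [mmul _ _]fmmulE.
Qed.

Lemma mon_nil : mon [::] = 1.
Proof.
by rewrite /mon basE -fmoneE.
Qed.

Lemma mcoeff_mon s t : (mon s)@_(FMonom t) = (s == t)%:R.
Proof. exact: mcoeff_bas. Qed.

Lemma malg_scaleAr c (u v : A) : u * (c *: v) = c *: (u * v).
Proof.
rewrite (malgMEw (fsubset_refl _) (msuppZ_le c v)) malgME scaler_sumr.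
apply: eq_bigr => k _; rewrite scaler_sumr; apply: eq_bigr => k' _.
by rewrite !bas_scale mcoeffZ mulrCA scalerA.
Qed.

Lemma malg_scale_sandwich c d (a u b : A) :
  (c *: a) * (u * (d *: b)) = (c * d) *: (a * u * b).
Proof. by rewrite -scalerAl !malg_scaleAr scalerA mulrA. Qed.

Lemma sum_sandwich (I J : Type) (r : seq I) (s : seq J) (c : I -> F) (d : J -> F)
    (f : I -> A) (g : J -> A) (u : A) :
  (\sum_(i <- r) c i *: f i) * u * (\sum_(j <- s) d j *: g j) =
  \sum_(i <- r) \sum_(j <- s) (c i * d j) *: (f i * u * g j).
Proof.
rewrite -mulrA mulr_suml; apply: eq_bigr => i _.
rewrite [u * _]mulr_sumr mulr_sumr; apply: eq_bigr => j _.
exact: malg_scale_sandwich.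
Qed.

Variable wt : K -> nat.
Local Notation wwt := (wwt wt).

Lemma wwt_cat s t : wwt (s ++ t) = (wwt s + wwt t)%N.
Proof. exact: big_cat. Qed.

Lemma wwt_cons k s : wwt (k :: s) = (wt k + wwt s)%N.
Proof. exact: big_cons. Qed.

Lemma wwt_nil : wwt [::] = 0%N.
Proof. exact: big_nil. Qed.

Definition wbounded : nat -> A -> Prop := bounded (fun w : {fmonom K} => wwt w).

Lemma wbounded_mon s n : (wwt s <= n)%N -> wbounded n (mon s).
Proof. by move=> le_s; apply: bounded_bas. Qed.

Lemma wbounded1 n : wbounded n (1 : A).
Proof. by rewrite -mon_nil; apply: wbounded_mon; rewrite wwt_nil. Qed.

Lemma wboundedM n n' (u v : A) :
  wbounded n u -> wbounded n' v -> wbounded (n + n') (u * v).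
Proof.
move=> bu bv; rewrite malgME big_seq; apply: bounded_sum => k.
rewrite -mcoeff_neq0 => nzk; rewrite big_seq; apply: bounded_sum => k'.
rewrite -mcoeff_neq0 => nzk'.
rewrite bas_scale; apply: boundedZ; apply: bounded_bas; rewrite fmM wwt_cat.
exact: leq_add (bounded_mem bu nzk) (bounded_mem bv nzk').
Qed.

End FreeAlgebra.

Lemma lext_mul (F : fieldType) (K K' : choiceType) (f g : K' -> {malg F[{fmonom K}]}) u v :
  lext f u * lext g v =
  \sum_(w <- msupp u) \sum_(w' <- msupp v) (u@_w * v@_w') *: (f w * g w').
Proof.
rewrite [lext f u]lextE mulr_suml; apply: eq_bigr => w _.
rewrite lextE mulr_sumr; apply: eq_bigr => w' _.
by rewrite -scalerAl malg_scaleAr scalerA.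
Qed.

Lemma below_mul (F : fieldType) (K : choiceType) (wt : K -> nat) n n'
    (u v : {malg F[{fmonom K}]}) :
  below (fun w : {fmonom K} => wwt wt w) n u -> wbounded wt n' v ->
  below (fun w : {fmonom K} => wwt wt w) (n + n') (u * v).
Proof.
move=> /belowP[->|[m -> bu]] bv; first by rewrite mul0r; apply: below0.
by apply: bounded_below (wboundedM bu bv).
Qed.

Lemma mul_below (F : fieldType) (K : choiceType) (wt : K -> nat) n n'
    (u v : {malg F[{fmonom K}]}) :
  wbounded wt n u -> below (fun w : {fmonom K} => wwt wt w) n' v ->
  below (fun w : {fmonom K} => wwt wt w) (n + n') (u * v).
Proof.
move=> bu /belowP[->|[m -> bv]]; first by rewrite mulr0; apply: below0.
by apply: bounded_below (wboundedM bu bv); rewrite addnS.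
Qed.

(** * Right actions of a free algebra on words *)

Section RightAction.
Variables (F : fieldType) (K : choiceType).
Local Notation A := {malg F[{fmonom K}]}.
Local Notation X := {malg F[seq K]}.

Section Action.
Variable op : seq K -> K -> X.

(** Letters are applied in reading order, so concatenation becomes composition, and any choice of
    [op] on basis words yields a right module over the free algebra. *)
Definition actw (s : seq K) (x : X) : X := foldl (fun x k => lext (op^~ k) x) x s.

Lemma actw_is_linear s : linear (actw s).
Proof.
rewrite /actw; elim: s => //= k s IH a x y; rewrite -IH; congr (foldl _ _ _).
exact: linearP.
Qed.

HB.instance Definition _ s :=
  GRing.isLinear.Build F X X *:%R (actw s) (actw_is_linear s).

Definition act (x : X) (u : A) : X := lext (fun w : {fmonom K} => actw w x) u.
Definition actr (u : A) (x : X) : X := act x u.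

HB.instance Definition _ x :=
  GRing.Linear.copy (act x) (lext (fun w : {fmonom K} => actw w x)).

Lemma actr_is_linear u : linear (actr u).
Proof.
move=> a x y; rewrite /actr /act !lextE scaler_sumr -big_split; apply: eq_bigr => w _ /=.
by rewrite linearP scalerDr !scalerA mulrC.
Qed.

HB.instance Definition _ u :=
  GRing.isLinear.Build F X X *:%R (actr u) (actr_is_linear u).

Lemma actE x u : act x u = actr u x.
Proof. by []. Qed.

Lemma act_mon x s : act x (mon F s) = actw s x.
Proof. exact: lext_bas. Qed.

Lemma act1 x : act x 1 = x.
Proof. by rewrite -mon_nil act_mon. Qed.

Lemma actM x u v : act x (u * v) = act (act x u) v.
Proof.
rewrite malgME linear_sum /= [RHS]actE [act x u]lextE linear_sum.
apply: eq_bigr => k _; rewrite linearZ /= -actE [act _ v]lextE linear_sum /= scaler_sumr.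
apply: eq_bigr => k' _; rewrite /= bas_scale linearZ /= [act x _]lext_bas scalerA fmM.
by congr (_ *: _); rewrite /actw foldl_cat.
Qed.

End Action.

Variable wt : K -> nat.
Local Notation xbounded := (bounded (@wwt K wt)).
Local Notation ubounded := (@wbounded F K wt).

Section BoundedAction.
Variable op : seq K -> K -> X.
Hypothesis op_bounded : forall m k, xbounded (wwt wt m + wt k) (op m k).

Lemma actw_bounded n x s : xbounded n x -> xbounded (n + wwt wt s) (actw op s x).
Proof.
elim: s n x => [|k s IH] n x bx /=; first by rewrite wwt_nil addn0.
rewrite wwt_cons addnA; apply: IH; apply: bounded_lext bx _ => m le_m.
by apply: (boundedW _ (@op_bounded m k)); rewrite leq_add2r.
Qed.

Lemma act_bounded n n' x u : xbounded n x -> ubounded n' u ->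
  xbounded (n + n') (act op x u).
Proof.
move=> bx bu; apply: bounded_lext bu _ => w le_w.
by apply: (boundedW _ (actw_bounded bx)); rewrite leq_add2l.
Qed.

Variables (op' : seq K -> K -> X) (N : nat).
Hypothesis eq_op : forall m k, (wwt wt m < N)%N -> op m k = op' m k.

(** Each letter raises the weight by at most its own weight, so while the total stays below [N] only
    words on which the two operators agree are met. *)
Lemma eq_actw n x s : xbounded n x -> (n + wwt wt s < N)%N ->
  actw op s x = actw op' s x.
Proof.
elim: s n x => [|k s IH] n x bx //=; rewrite wwt_cons addnA => lt.
rewrite -(_ : lext (op^~ k) x = lext (op'^~ k) x).
  apply: IH lt; apply: bounded_lext bx _ => m le_m.
  by apply: (boundedW _ (@op_bounded m k)); rewrite leq_add2r.
apply: eq_lext => m nz; apply: eq_op.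
have := bounded_mem bx nz; lia.
Qed.

Lemma eq_act n n' x u : xbounded n x -> ubounded n' u -> (n + n' < N)%N ->
  act op x u = act op' x u.
Proof.
move=> bx bu lt; apply: eq_lext => w nz; apply: (eq_actw bx).
have := bounded_mem bu nz; lia.
Qed.

(** For a single letter only the weight of the vector acted upon counts; this allows an arbitrarily
    heavy last letter. *)
Lemma eq_act_gen n x k : xbounded n x -> (n < N)%N ->
  act op x (mon F [:: k]) = act op' x (mon F [:: k]).
Proof.
move=> bx lt; rewrite !act_mon; apply: eq_lext => m nz; apply: eq_op.
exact: leq_ltn_trans (bounded_mem bx nz) lt.
Qed.

End BoundedAction.
End RightAction.

(** * The action on normal words *)

Section Operators.
Variables (F : fieldType) (V : finType) (E : rel V) (lvl : V -> nat).
Hypothesis lvl_edge : forall v w, E v w -> lvl v = (lvl w).+1.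

Fixpoint reach j u v :=
  if j is j'.+1 then [exists x, E u x && reach j' x v] else u == v.

Lemma reach_lvl j u v : reach j u v -> lvl u = (j + lvl v)%N.
Proof.
elim: j u => [|j IH] u /=; first by move/eqP->.
by case/existsP => x /andP[/lvl_edge-> /IH->].
Qed.

Lemma reach_trans i j u v w : reach i u v -> reach j v w -> reach (i + j) u w.
Proof.
elim: i u => [|i IH] u /=; first by move/eqP->.
case/existsP => x /andP[ux xv] vw; apply/existsP; exists x.
by rewrite ux (IH x).
Qed.

Lemma reach1 u v : E u v -> reach 1 u v.
Proof. by move=> uv; apply/existsP; exists v; rewrite uv /=. Qed.

(* The symbol [(v, k)] stands for the coefficient of t^(|v|-k) (up to sign) in
   the product of the (t - e_i) along any path from [v] to the bottom. *)
Local Notation sym := (V * nat)%type.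
Local Notation A := {malg F[{fmonom sym}]}.
Local Notation X := {malg F[seq sym]}.

(** For k at most |v|, this is the total level of the first k vertices of a path descending from v,
    hence the weight of the leading word of e(v,k). *)
Definition swt (s : sym) : nat := (\sum_(q < s.2) (lvl s.1 - q))%N.
Local Notation wt := (wwt swt).
Local Notation xbounded := (bounded (@wwt sym swt)).
Local Notation ubounded := (@wbounded F sym swt).

Lemma swt_split u l k :
  (swt (u, l + k) = swt (u, l) + \sum_(q < k) (lvl u - l - q))%N.
Proof.
by rewrite /swt big_split_ord /=; congr addn; apply: eq_bigr => q _; rewrite subnDA.
Qed.

Lemma swt0 v : swt (v, 0%N) = 0%N.
Proof. exact: big_ord0. Qed.

Lemma swt_reach j u v k : lvl u = (j + lvl v)%N ->
  swt (u, (j + k)%N) = (swt (u, j) + swt (v, k))%N.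
Proof. by move=> uv; rewrite swt_split uv addKn. Qed.

Lemma swt_subadd v i k : (swt (v, i + k) <= swt (v, i) + swt (v, k))%N.
Proof. by rewrite swt_split leq_add2l; apply: leq_sum => q _ /=; lia. Qed.

Lemma swt_shift j u v i k : lvl u = (j + lvl v)%N -> (i + k <= j)%N ->
  (swt (u, i) + swt (v, k) <= swt (u, i + k))%N.
Proof.
by move=> uv ikj; rewrite swt_split leq_add2l; apply: leq_sum => q _ /=; lia.
Qed.

Lemma swt_shift_lt j u v i k : lvl u = (j + lvl v)%N -> (i + k <= j)%N ->
  (0 < k)%N -> (swt (u, i) + swt (v, k) < swt (u, i + k))%N.
Proof.
case: k => // k uv ikj _; rewrite swt_split ltn_add2l /swt /= !big_ord_recl /= -addSn.
by apply: leq_add; [lia | apply: leq_sum => q _ /=; rewrite /bump; lia].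
Qed.

(** After l < j steps a path from [u] to [v] is still strictly above [v], so restarting at [v] loses
    weight. This drop makes the recursion defining the action and the later inductions well
    founded. *)
Lemma swt_split_lt j u v l : lvl u = (j + lvl v)%N -> (l < j)%N ->
  (swt (u, l) + swt (v, j - l)%N < swt (u, j))%N.
Proof.
move=> uv lj; have := @swt_shift_lt _ _ _ l (j - l) uv.
by rewrite subnKC ?(ltnW lj) // leqnn subn_gt0 lj; apply.
Qed.

(** The coefficients of P_v, with constant term 1 and degree at most |v|, the number of edges of a
    path from v to the bottom. *)
Definition pcoef v k : A :=
  if k == 0%N then 1 else if (k <= lvl v)%N then mon F [:: (v, k)] else 0.

Definition qcoef u v : nat -> A := rdiv (pcoef u) (pcoef v).

Lemma pcoef0 v : pcoef v 0 = 1.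
Proof. by []. Qed.

Lemma pcoef_gt v k : (lvl v < k)%N -> pcoef v k = 0.
Proof. by rewrite /pcoef; case: k => // k; rewrite ltnNge => /negbTE->. Qed.

Lemma pcoefE v k : (0 < k <= lvl v)%N -> pcoef v k = mon F [:: (v, k)].
Proof. by rewrite /pcoef; case: k => // k /= ->. Qed.

Lemma pcoef_bounded v k : ubounded (swt (v, k)) (pcoef v k).
Proof.
rewrite /pcoef; case: ifP => _; first exact: wbounded1.
case: ifP => _; last exact: bounded0.
by apply: wbounded_mon; rewrite wwt_cons wwt_nil addn0.
Qed.

Lemma qcoefE u v n : pcoef u n = \sum_(i < n) qcoef u v i * pcoef v (n - i)%N + qcoef u v n.
Proof. by rewrite /qcoef [X in _ + X]rdivE addrC subrK. Qed.

Lemma qcoef0 u v : qcoef u v 0 = 1.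
Proof. by rewrite /qcoef rdiv0. Qed.

Lemma qcoef_conv z u v n : qcoef z v n = conv (qcoef z u) (qcoef u v) n.
Proof. exact: rdiv_conv. Qed.

(** Induction through the division recursion: by [swt_shift], up to degree [j] a product of terms of
    index i and l - i is no heavier than e(u,l). *)
Lemma qcoef_bounded j u v l : lvl u = (j + lvl v)%N -> (l <= j)%N ->
  ubounded (swt (u, l)) (qcoef u v l).
Proof.
move=> uv; elim/ltn_ind: l => l IH lj; rewrite /qcoef rdivE.
apply: boundedB; first exact: pcoef_bounded.
apply: bounded_sum => i _; have il := ltn_ord i.
apply: (boundedW (n := (swt (u, i : nat) + swt (v, l - i)%N)%N)).
  have := @swt_shift _ _ _ i (l - i) uv; rewrite subnKC; last exact: ltnW.
  exact.
by apply: wboundedM; [apply: IH => //; lia | apply: pcoef_bounded].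
Qed.

(** The head of the list is the last symbol of the word; a symbol at a covered vertex would create a
    forbidden factor when appended. *)
Definition covered (m : seq sym) v :=
  if m is (z, a) :: _ then reach a z v else false.

Fixpoint normal (m : seq sym) :=
  if m is (u, j) :: m' then [&& (0 < j <= lvl u)%N, ~~ covered m' u & normal m']
  else true.

(* Words are stored in reverse, so that the action adds symbols at the head.
   The correction sum is what [m' (e(u,j) e(v,k) - e(u,j+k))] must be in view
   of [P_u = C P_v], where [C = P_u P_v^-1] has degree [j]. *)
Definition op_step (rec : seq sym -> sym -> X) (m : seq sym) (s : sym) : X :=
  if normal m then
    if m is (u, j) :: m' then
      if reach j u s.1 then
        (bas ((u, (j + s.2)%N) :: m')) + \sum_(l < j)
          (act rec (act rec (bas (m')) (qcoef u s.1 l * pcoef s.1 (j - l)%N)) (mon F [:: s])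
           - act rec (bas (m')) (qcoef u s.1 l * pcoef s.1 (j - l + s.2)%N))
      else (bas (s :: m))
    else (bas ([:: s]))
  else 0.

Section Step.
Variable rec : seq sym -> sym -> X.
Hypothesis rec_bounded : forall m s, xbounded (wt m + swt s) (rec m s).

Lemma op_step_bounded m s : xbounded (wt m + swt s) (op_step rec m s).
Proof.
case: s => [v k]; rewrite /op_step.
case: ifP => [nm|_]; last exact: bounded0.
case: m nm => [|[u j] m].
  by move=> _; apply: bounded_bas; rewrite !wwt_cons wwt_nil addn0.
case/and3P => /andP[j0 ju] _ nm.
case: ifP => [/reach_lvl uv|_]; last first.
  by apply: bounded_bas; rewrite !wwt_cons addnC.
have bm : xbounded (wt m) (bas m : X) by apply: bounded_bas.
apply: boundedD.
  by apply: bounded_bas; rewrite !wwt_cons (swt_reach _ uv) => /=; lia.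
rewrite wwt_cons; apply: bounded_sum => l _; have lj := ltn_ord l.
have bq := qcoef_bounded uv (ltnW lj).
have lt := swt_split_lt uv lj.
apply: boundedB.
  apply: (boundedW (n := (wt m + (swt (u, l : nat) + swt (v, j - l)%N) + swt (v, k))%N)).
    by move: lt => /=; lia.
  apply: (act_bounded rec_bounded).
    apply: (act_bounded rec_bounded) => //.
    by apply: wboundedM bq _; apply: pcoef_bounded.
  by apply: wbounded_mon; rewrite wwt_cons wwt_nil addn0.
apply: (boundedW (n := (wt m + (swt (u, l : nat) + swt (v, j - l + k)%N))%N)).
  by move: lt (swt_subadd v (j - l) k) => /=; lia.
apply: (act_bounded rec_bounded) => //.
by apply: wboundedM bq _; apply: pcoef_bounded.
Qed.

Variables (rec' : seq sym -> sym -> X) (N : nat).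
Hypothesis eq_rec : forall m s, (wt m < N)%N -> rec m s = rec' m s.

Lemma eq_act_pcoef n x v k : xbounded n x -> (n < N)%N ->
  act rec x (pcoef v k) = act rec' x (pcoef v k).
Proof.
move=> bx lt; rewrite /pcoef; case: ifP => _; first by rewrite !act1.
by case: ifP => _; [apply: (eq_act_gen eq_rec _ bx) | rewrite !linear0].
Qed.

(** The corrections consult [rec] only on words strictly lighter than [m]: any symbol that could be
    too heavy is applied last. *)
Lemma eq_op_step m s : (wt m <= N)%N -> op_step rec m s = op_step rec' m s.
Proof.
case: s => [v k] le_N; rewrite /op_step.
case nm: (normal m); last by [].
case: m nm le_N => [|[u j] m]; first by [].
case/and3P => /andP[j0 ju] _ nm; rewrite wwt_cons => le_N.
rewrite [(v, k).1]/=; case uv: (reach j u v); last by [].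
move/reach_lvl: uv => uv; apply: (congr1 (+%R _)); apply: eq_bigr => l _.
have lj := ltn_ord l; have bq := qcoef_bounded uv (ltnW lj).
have lt := swt_split_lt uv lj.
have bm : xbounded (wt m) (bas m : X) by apply: bounded_bas.
have bqp := wboundedM bq (@pcoef_bounded v (j - l)).
have ltN : (wt m + (swt (u, l : nat) + swt (v, j - l)%N) < N)%N.
  by move: lt le_N => /=; lia.
apply: (congr2 (fun x y : X => x - y)).
  rewrite -(eq_act rec_bounded eq_rec bm bqp ltN).
  exact: (eq_act_gen eq_rec _ (act_bounded rec_bounded bm bqp)).
(* The symbol e(v, j-l+k) may be too heavy for [eq_act], so the product is split and only the weight
   reached before this last factor is used. *)
have ltN' : (wt m + swt (u, l : nat) < N)%N by move: ltN => /=; lia.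
rewrite !actM -(eq_act rec_bounded eq_rec bm bq ltN').
exact: (eq_act_pcoef _ _ (act_bounded rec_bounded bm bq)).
Qed.

End Step.

(** Recursion on weight by means of fuel: any fuel exceeding the weight of the word gives the same
    value, and [opw] takes the least such fuel. *)
Fixpoint op (n : nat) : seq sym -> sym -> X :=
  if n is n'.+1 then op_step (op n') else fun _ _ => 0.

Definition opw m : sym -> X := op (wt m).+1 m.

Lemma op_bounded n m s : xbounded (wt m + swt s) (op n m s).
Proof.
elim: n m s => [|n IH] m s; first exact: bounded0.
exact: op_step_bounded.
Qed.

Lemma eq_op n n' m s : (wt m < n)%N -> (wt m < n')%N -> op n m s = op n' m s.
Proof.
elim: n n' m s => [|n IH] n' m s; first by rewrite ltn0.
case: n' => [|n']; first by move=> _; rewrite ltn0.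
rewrite !ltnS => le_n le_n'; apply: (eq_op_step (@op_bounded n) (N := wt m)).
  by move=> m' s' lt; apply: IH; apply: leq_trans lt _.
exact: leqnn.
Qed.

Lemma opwE m s : opw m s = op_step opw m s.
Proof.
apply: (eq_op_step (@op_bounded (wt m)) (N := wt m)); last exact: leqnn.
by move=> m' s' lt; apply: eq_op; last exact: ltnSn.
Qed.

(* Locked: unification would otherwise unfold nested actions. *)
Fact dot_key : unit. Proof. by []. Qed.
Definition dot : X -> A -> X := locked_with dot_key (act opw).
Lemma dot_unlock : dot = act opw. Proof. by rewrite /dot unlock. Qed.

Definition rdot u x := dot x u.

Lemma dot_is_linear x : linear (dot x).
Proof. by rewrite dot_unlock; apply: linearP. Qed.

HB.instance Definition _ x :=
  GRing.isLinear.Build F A X *:%R (dot x) (dot_is_linear x).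

Lemma rdot_is_linear u : linear (rdot u).
Proof. by rewrite /rdot dot_unlock; apply: (linearP (actr opw u)). Qed.

HB.instance Definition _ u :=
  GRing.isLinear.Build F X X *:%R (rdot u) (rdot_is_linear u).

Lemma dotE x u : dot x u = rdot u x.
Proof. by []. Qed.

Lemma dot_bounded n n' x u : xbounded n x -> ubounded n' u ->
  xbounded (n + n') (dot x u).
Proof. by rewrite dot_unlock; apply: act_bounded => m s; apply: op_bounded. Qed.

Lemma dotM x u v : dot x (u * v) = dot (dot x u) v.
Proof. by rewrite dot_unlock actM. Qed.

Lemma dot1 x : dot x 1 = x.
Proof. by rewrite dot_unlock act1. Qed.

Lemma dot_gen m s : dot (bas m) (mon F [:: s]) = op_step opw m s.
Proof. by rewrite dot_unlock act_mon /actw /= lext_bas opwE. Qed.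

Lemma dot_append m v k : normal m -> ~~ covered m v ->
  dot (bas m) (mon F [:: (v, k)]) = (bas ((v, k) :: m)).
Proof.
move=> nm ncov; rewrite dot_gen /op_step nm; case: m nm ncov => [|[u j] m] //= _.
by move/negbTE->.
Qed.

Lemma dot_cover m u j v k : normal ((u, j) :: m) -> reach j u v ->
  dot (bas ((u, j) :: m)) (mon F [:: (v, k)]) =
    (bas ((u, (j + k)%N) :: m)) + \sum_(l < j)
      (dot (dot (bas m) (qcoef u v l * pcoef v (j - l)%N)) (mon F [:: (v, k)])
       - dot (bas m) (qcoef u v l * pcoef v (j - l + k)%N)).
Proof.
move=> nm uv; rewrite dot_gen /op_step nm [(v, k).1]/= [(v, k).2]/= uv.
by rewrite dot_unlock.
Qed.

Lemma dot_nonnormal m v k : ~~ normal m -> (0 < k)%N -> dot (bas m) (pcoef v k) = 0.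
Proof.
move=> nn k0; case: (leqP k (lvl v)) => kv; last by rewrite pcoef_gt // linear0.
by rewrite pcoefE ?k0 // dot_gen /op_step (negbTE nn).
Qed.

Lemma dot_pcoef_append m v k : normal m -> ~~ covered m v -> (0 < k <= lvl v)%N ->
  dot (bas m) (pcoef v k) = (bas ((v, k) :: m)).
Proof. by move=> nm ncov kv; rewrite pcoefE // dot_append. Qed.

(* The defining equation of the action, read as [P_u = C P_v] in degree [j + k],
   where [C] is the truncation of [P_u P_v^-1] at degree [j]. *)
Lemma dot_pcoef_reach m u j v k : normal m -> ~~ covered m u -> reach j u v ->
  (0 < k)%N ->
  dot (bas m) (pcoef u (j + k)%N) =
    \sum_(l < j.+1) dot (bas m) (qcoef u v l * pcoef v (j + k - l)%N).
Proof.
move=> nm ncov uv k0; have lvl_uv := reach_lvl uv.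
(* If k > |v|, every term is zero for degree reasons, since j + k - l is at least k for l at most
   j. *)
have [kv|kv] := ltnP (lvl v) k.
  rewrite pcoef_gt ?linear0; last by lia.
  rewrite big1 // => l _; rewrite (pcoef_gt (v := v)) ?mulr0 ?linear0 //.
  by have := ltn_ord l; lia.
case: (posnP j) => [j0|j0].
  move: uv lvl_uv; rewrite j0 /= => /eqP-> _.
  by rewrite big_ord_recl big_ord0 addr0 qcoef0 mul1r subn0.
have nuj : normal ((u, j) :: m) by rewrite /= j0 ncov nm lvl_uv leq_addr.
pose S1 : X := \sum_(l < j) dot (dot (bas m) (qcoef u v l * pcoef v (j - l)%N)) (pcoef v k).
pose S2 : X := \sum_(l < j) dot (bas m) (qcoef u v l * pcoef v (j - l + k)%N).
have -> : \sum_(l < j.+1) dot (bas m) (qcoef u v l * pcoef v (j + k - l)%N) =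
          S2 + dot (dot (bas m) (qcoef u v j)) (pcoef v k).
  rewrite big_ord_recr; apply: (congr2 (fun x y : X => x + y)); last by rewrite -dotM addKn.
  by apply: eq_bigr => l _; rewrite addnBAC // ltnW.
(* Both basis words are written as symbols applied to [bas m], and e(u,j) is expanded by the
   division recursion. Then [S1] occurs on both sides and cancels. *)
have := dot_cover k nuj uv.
rewrite -pcoefE ?k0 // -(dot_pcoef_append nm ncov); last by rewrite j0 lvl_uv leq_addr.
rewrite -(dot_pcoef_append nm ncov); last by lia.
rewrite {1}(qcoefE u v j) linearD /= linear_sum /= -[dot (_ + _) _]/(rdot _ _).
rewrite linearD linear_sum sumrB => H.
have {}H : S1 + dot (dot (bas m) (qcoef u v j)) (pcoef v k) =
           dot (bas m) (pcoef u (j + k)%N) + (S1 - S2) := H.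
move: (dot (dot (bas m) (qcoef u v j)) (pcoef v k)) (dot (bas m) (pcoef u (j + k)%N)) S1 S2 H.
by move=> d p s1 s2 H; apply: (addrI s1); rewrite [RHS]addrCA H [RHS]addrCA [s2 + _]addrC subrK addrC.
Qed.

(* [P_u P_v^-1] acts as a polynomial of degree [j] when [u] reaches [v] in [j]
   steps. For a word covering [u] this uses the factorization of
   [P_z P_v^-1] through [P_u], where [z] is the last vertex of the word. *)
Lemma dot_qcoef_uncovered m u j v n : normal m -> ~~ covered m u -> reach j u v ->
  (j < n)%N -> dot (bas m) (qcoef u v n) = 0.
Proof.
move=> nm ncov uv; elim/ltn_ind: n => n IH jn.
have := dot_pcoef_reach (k := n - j) nm ncov uv.
rewrite subn_gt0 subnKC ?(ltnW jn) // => /(_ jn).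
(* Two expansions of e(u,n) are compared: they share the terms up to index [j], and those strictly
   between [j] and [n] vanish by induction, which leaves only the coefficient of index [n]. *)
rewrite (qcoefE u v n) linearD linear_sum /= => H.
pose f l : X := dot (bas m) (qcoef u v l * pcoef v (n - l)%N).
have tail0 : \sum_(j.+1 <= l < n) f l = 0.
  rewrite big_nat big1 // => l /andP[jl ln].
  by rewrite /f dotM (IH l) // dotE linear0.
have fsum : \sum_(l < n) f l = \sum_(l < j.+1) f l.
  rewrite -(big_mkord xpredT f) -(big_mkord xpredT f).
  rewrite [LHS](big_cat_nat (n := j.+1)) //= tail0; exact: addr0.
move: H; rewrite -/(f _) fsum => H; apply: (addrI (\sum_(l < j.+1) f l)).
by rewrite H; apply/esym/addr0.
Qed.

Lemma dot_vanish x u n : xbounded n x ->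
  (forall m, (wt m <= n)%N -> dot (bas m) u = 0) -> dot x u = 0.
Proof.
move=> bx H; rewrite {1}[x]malg_lextE lextE dotE linear_sum big_seq big1 // => m.
rewrite -mcoeff_neq0 => /(bounded_mem bx) le_m.
by rewrite linearZ /= -dotE H // scaler0.
Qed.

(** The action sends non-normal words to zero, so vanishing can be stated on all basis words. *)
Lemma dot_qcoef_nonnormal m u v n : ~~ normal m -> (0 < n)%N ->
  dot (bas m) (qcoef u v n) = 0.
Proof.
move=> nm; elim/ltn_ind: n => n IH n0.
rewrite /qcoef rdivE linearB /= (dot_nonnormal _ nm) // sub0r.
rewrite linear_sum /= big1 ?oppr0 // => i _; rewrite dotM.
case: (posnP i) => [->|i0]; last by rewrite IH // dotE linear0.
by rewrite rdiv0 pcoef0 dot1 subn0; apply: dot_nonnormal.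
Qed.

Lemma dot_qcoef_eq0 m u j v n : reach j u v -> (j < n)%N ->
  dot (bas m) (qcoef u v n) = 0.
Proof.
have [k] := ubnP (wt m); elim: k m u j v n => // k IH m u j v n.
rewrite ltnS => le_m uv jn.
have [nm|nm] := boolP (normal m); last first.
  by apply: dot_qcoef_nonnormal => //; lia.
have [cov|] := boolP (covered m u); last first.
  by move=> ncov; apply: (dot_qcoef_uncovered nm ncov uv jn).
case: m nm cov le_m => // -[z a] m nm /= zu.
rewrite wwt_cons => le_m; have:= nm; case/and3P=> /andP[a0 az] ncov nm'.
have lvl_zu := reach_lvl zu.
have bm : xbounded (wt m) (bas m : X) by apply: bounded_bas.
have small (x : X) N n' : xbounded N x -> (N < swt (z, a) + wt m)%N -> (j < n')%N ->
    dot x (qcoef u v n') = 0.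
  move=> bx ltN jn'; apply: dot_vanish bx _ => m1 le_m1.
  by apply: IH uv jn'; move: le_m1 le_m ltN => /=; lia.
(* Degree a + n of P_z P_v^-1 = (P_z P_u^-1)(P_u P_v^-1) acts as zero on [bas m]. Terms with l > a
   vanish because z reaches u in a steps, those with l < a by induction on weight; hence so does the
   term l = a. *)
have zero_a : dot (dot (bas m) (qcoef z u a)) (qcoef u v n) = 0.
  have := dot_qcoef_uncovered (n := a + n) nm' ncov (reach_trans zu uv).
  rewrite ltn_add2l => /(_ jn).
  rewrite (qcoef_conv z u) /conv linear_sum /=.
  have lta : (a < (a + n).+1)%N by lia.
  rewrite (bigD1 (Ordinal lta)) //= big1; first by rewrite addr0 dotM addKn.
  move=> l /eqP/val_eqP /= l_neq; rewrite dotM.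
  have [la|al] := ltnP l a; last first.
    by rewrite (dot_qcoef_uncovered (n := l) nm' ncov zu) ?dotE ?linear0 //; lia.
  apply: (small _ (wt m + swt (z, l : nat))%N); last by lia.
    by apply: dot_bounded bm _; apply: qcoef_bounded lvl_zu _; apply: ltnW.
  have := swt_split_lt lvl_zu la; move=> /=; lia.
(* The word is e(z,a) applied to [m]. Expanding e(z,a) by division by P_u leaves the term just
   treated and strictly lighter vectors. *)
rewrite -(dot_pcoef_append nm' ncov); last by rewrite a0.
rewrite (qcoefE z u a) linearD dotE linearD /= -!dotE zero_a addr0.
rewrite linear_sum /= dotE linear_sum big1 // => i _; rewrite /= -dotE.
apply: (small _ (wt m + (swt (z, i : nat) + swt (u, a - i)%N))%N _ _ _ jn).
  apply: dot_bounded bm _; apply: wboundedM; last exact: pcoef_bounded.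
  by apply: qcoef_bounded lvl_zu _; apply: ltnW.
by have := swt_split_lt lvl_zu (ltn_ord i); move=> /=; lia.
Qed.
End Operators.

(** * Representatives and ideals *)

Section MonomialSubstitution.
Variables (F : fieldType) (K K' : choiceType) (f : K -> K').

Definition msubst : {malg F[{fmonom K}]} -> {malg F[{fmonom K'}]} :=
  lext (fun w : {fmonom K} => mon F (map f w)).

HB.instance Definition _ :=
  GRing.Linear.copy msubst (lext (fun w : {fmonom K} => mon F (map f w))).

Lemma msubst_mon s : msubst (mon F s) = mon F (map f s).
Proof. exact: lext_bas. Qed.

Lemma msubst1 : msubst 1 = 1.
Proof. by rewrite -mon_nil msubst_mon mon_nil. Qed.

Lemma msubstM u v : msubst (u * v) = msubst u * msubst v.
Proof.
rewrite malgME linear_sum /= [msubst u]lextE mulr_suml.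
apply: eq_bigr => k _; rewrite linear_sum /= [msubst v]lextE mulr_sumr.
apply: eq_bigr => k' _; rewrite /= bas_scale linearZ /= [msubst _]lext_bas fmM.
by rewrite -scalerAl malg_scaleAr scalerA monM map_cat.
Qed.

End MonomialSubstitution.

Section Representatives.
Variables (F : fieldType) (V : finType) (lvl : V -> nat).
Local Notation Vp := (Vp lvl).
Local Notation Tel := (Tel F lvl).
Local Notation T := {malg F[{fmonom Vp}]}.

(** Interprets representatives in the algebra of words, where [teq] becomes equality. *)
Definition tel (x : Tel) : T := \sum_(p <- x) p.1 *: mon F p.2.

Lemma telE x : tel x = \sum_(p <- x) p.1 *: mon F p.2.
Proof. by []. Qed.

Lemma mcoeff_tel x w : (tel x)@_(FMonom w) = coef x w.
Proof.
rewrite /tel raddf_sum; apply: eq_bigr => p _; rewrite /= mcoeffZ mcoeff_mon.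
by case: eqP => _; rewrite ?mulr1 ?mulr0.
Qed.

Lemma teqP x y : teq x y <-> tel x = tel y.
Proof.
split=> [xy|xy w]; last by rewrite -!mcoeff_tel xy.
by apply/malgP => w; rewrite -[w]fmK !mcoeff_tel.
Qed.

Lemma tel0 : tel (tzero F lvl) = 0.
Proof. exact: big_nil. Qed.

Lemma tel_word w : tel (tword F w) = mon F w.
Proof. by rewrite /tel big_seq1 scale1r. Qed.

Lemma tel_word2 w w' : tel [:: (1, w); (-1, w')] = mon F w - mon F w'.
Proof. by rewrite /tel big_cons big_seq1 scale1r scaleN1r. Qed.

Lemma tel1 : tel (tone F lvl) = 1.
Proof. by rewrite /tel big_seq1 scale1r mon_nil. Qed.

Lemma telD x y : tel (tadd x y) = tel x + tel y.
Proof. exact: big_cat. Qed.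

Lemma telZ c x : tel (tscale c x) = c *: tel x.
Proof.
by rewrite /tel big_map scaler_sumr; apply: eq_bigr => p _; rewrite scalerA.
Qed.

Lemma telN x : tel (topp x) = - tel x.
Proof. by rewrite telZ scaleN1r. Qed.

Lemma telB x y : tel (tsub x y) = tel x - tel y.
Proof. by rewrite telD telN. Qed.

Lemma telM x y : tel (tmul x y) = tel x * tel y.
Proof.
rewrite /tel big_allpairs_dep mulr_suml; apply: eq_bigr => p _.
rewrite mulr_sumr; apply: eq_bigr => q _.
by rewrite -scalerAl malg_scaleAr scalerA monM.
Qed.

Lemma tel_sandwich x y (u : T) : tel x * u * tel y =
  \sum_(p <- x) \sum_(q <- y) (p.1 * q.1) *: (mon F p.2 * u * mon F q.2).
Proof.
exact: sum_sandwich.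
Qed.

Lemma tel_sum l : tel (tsum l) = \sum_(x <- l) tel x.
Proof. by elim: l => [|x l IH]; rewrite ?big_nil ?tel0 // big_cons telD IH. Qed.

Lemma tel_surj (u : T) : exists x, tel x = u.
Proof.
exists [seq (u@_w, w : seq Vp) | w <- msupp u]; rewrite [RHS]malg_lextE lextE /tel big_map.
by apply: eq_bigr => w _; rewrite /mon fmK.
Qed.

Section Ideal.
Variable S : Tel -> Prop.

Definition idl (u : T) : Prop := exists l : seq (Tel * Tel * Tel),
  (forall t, List.In t l -> S t.1.2) /\
  u = \sum_(t <- l) tel t.1.1 * tel t.1.2 * tel t.2.

Lemma in_idealP x : in_ideal S x <-> idl (tel x).
Proof.
have E (l : seq (Tel * Tel * Tel)) :
    tel (tsum [seq tmul (tmul t.1.1 t.1.2) t.2 | t <- l]) =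
    \sum_(t <- l) tel t.1.1 * tel t.1.2 * tel t.2.
  by rewrite tel_sum big_map; apply: eq_bigr => t _; rewrite !telM.
split=> -[l [Sl xl]]; exists l; split=> //; last by apply/teqP; rewrite E.
by move/teqP: xl => ->.
Qed.

Lemma idl_gen x : S x -> idl (tel x).
Proof.
move=> Sx; exists [:: (tone F lvl, x, tone F lvl)]; split=> [t [<-|[]]//|].
by rewrite big_seq1 /= tel1 mul1r mulr1.
Qed.

Lemma idl0 : idl 0.
Proof. by exists [::]; split=> //; rewrite big_nil. Qed.

Lemma idlD u v : idl u -> idl v -> idl (u + v).
Proof.
move=> [l [Sl ->]] [l' [Sl' ->]]; exists (l ++ l'); split; last by rewrite big_cat.
by move=> t Ht; case: (List.in_app_or _ _ _ Ht) => [/Sl|/Sl'].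
Qed.

Lemma idlMl a u : idl u -> idl (a * u).
Proof.
have [x <-] := tel_surj a; move=> [l [Sl ->]].
exists [seq (tmul x t.1.1, t.1.2, t.2) | t <- l]; split.
  by move=> t Ht; have [t' [<- /Sl]] := proj1 (List.in_map_iff _ _ _) Ht.
by rewrite big_map mulr_sumr; apply: eq_bigr => t _; rewrite /= telM !mulrA.
Qed.

Lemma idlMr a u : idl u -> idl (u * a).
Proof.
have [x <-] := tel_surj a; move=> [l [Sl ->]].
exists [seq (t.1.1, t.1.2, tmul t.2 x) | t <- l]; split.
  by move=> t Ht; have [t' [<- /Sl]] := proj1 (List.in_map_iff _ _ _) Ht.
rewrite big_map mulr_suml; apply: eq_bigr => t _; rewrite telM.
exact: (esym (mulrA _ _ _)).
Qed.

Lemma idlZ c u : idl u -> idl (c *: u).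
Proof. by move/(idlMl c%:MP); rewrite mul_malgC. Qed.

Lemma idl_sum (I : eqType) (r : seq I) (P : pred I) (f : I -> T) :
  (forall i, i \in r -> P i -> idl (f i)) -> idl (\sum_(i <- r | P i) f i).
Proof.
move=> H; rewrite big_seq_cond; elim/big_ind: _ => //; first exact: idl0.
  exact: idlD.
by move=> i /andP[]; apply: H.
Qed.

End Ideal.
End Representatives.

Lemma size_prod_lin (F : fieldType) (V : finType) (lvl : V -> nat) (l : seq (Tel F lvl)) :
  size (prod_lin l) = (size l).+1.
Proof. by elim: l => //= x l IH; rewrite size_map size_iota IH. Qed.

Lemma tel_nth_prod_lin (F : fieldType) (V : finType) (lvl : V -> nat)
    (x : Tel F lvl) (l : seq (Tel F lvl)) j :
  let c i := tel (nth (tzero F lvl) (prod_lin l) i) in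
  tel (nth (tzero F lvl) (prod_lin (x :: l)) j) =
    (if j is j'.+1 then c j' else 0) - tel x * c j.
Proof.
move=> c; rewrite /= /lin_mul.
have c_out i : (size (prod_lin l) <= i)%N -> c i = 0.
  by move=> le; rewrite /c nth_default // tel0.
case: (ltnP j (size (prod_lin l)).+1) => [lt|ge].
  rewrite (nth_map 0%N) ?size_iota // nth_iota // add0n telB telM.
  by case: j {lt} => //=; rewrite tel0.
rewrite nth_default ?size_map ?size_iota // tel0 c_out; last by apply: ltnW.
by case: j ge => // j ge; rewrite c_out // mulr0 subr0.
Qed.

(** * Relations of A(Gamma) act as zero *)

Section SignedStep.
Variables (R : nzRingType) (ann : R -> Prop).
Hypotheses (ann0 : ann 0) (annD : forall u v, ann u -> ann v -> ann (u + v)).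
Hypotheses (annMl : forall u v, ann v -> ann (u * v)).

(** The coefficient of t^i in the sum of (-1)^k q_k t^(n-k), the shape of a product of n factors t -
    e. *)
Definition signed n (q : nat -> R) i : R :=
  if (i <= n)%N then (-1) ^+ (n - i) * q (n - i)%N else 0.

(** The recursion for the coefficients of (t - x)Q matches, up to sign, q_v(k+1) = q_w(k+1) + x
    q_w(k). At j = 0 the shifted coefficient is missing, which is why [qw n.+1] has to lie in
    [ann]. *)
Lemma signed_step (x : R) (c qv qw : nat -> R) n j :
  qv 0%N = 1 -> qw 0%N = 1 -> ann (qw n.+1) ->
  (forall k, ann (qv k.+1 - (qw k.+1 + x * qw k))) ->
  (forall i, ann (c i - signed n qw i)) ->
  ann ((if j is j'.+1 then c j' else 0) - x * c j - signed n.+1 qv j).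
Proof.
move=> qv0 qw0 qwn edge cq.
have annN u : ann u -> ann (- u) by rewrite -mulN1r; apply: annMl.
have annB u v : ann u -> ann v -> ann (u - v) by move=> *; apply: annD => //; apply: annN.
pose q' := (if j is j'.+1 then signed n qw j' else 0) - x * signed n qw j.
pose c' := (if j is j'.+1 then c j' else 0) - x * c j.
have c'q' : ann (c' - q').
  have -> : c' - q' = (if j is j'.+1 then c j' - signed n qw j' else 0)
                      - x * (c j - signed n qw j).
    rewrite /c' /q' mulrBr !opprB; case: j {c' q'} => [|j].
      by rewrite !sub0r subr0 add0r addrC.
    by rewrite [LHS]addrACA [RHS]addrACA [X in _ + X = _]addrC.
  by apply: annB; [case: j {c' q'} | apply: annMl].
rewrite -/c' -[c'](subrK q') -addrA; apply: annD c'q' _; rewrite {c'}.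
have [nj|jn] := ltnP n j.
  rewrite /q' /signed [(j <= n)%N]leqNgt nj mulr0 subr0; case: j nj {q'} => // j.
  rewrite ltnS leq_eqVlt => /orP[/eqP<-|nj].
    by rewrite leqnn ltnSn !subnn !expr0 qv0 qw0 subrr.
  by rewrite leqNgt nj ltnS leqNgt nj subrr.
rewrite /q' /signed jn leqW // subSn // {q'}.
have -> : (if j is j'.+1 then if (j' <= n)%N then (-1) ^+ (n - j') * qw (n - j')%N else 0
           else 0) = (-1) ^+ (n - j).+1 * (if j is j'.+1 then qw (n - j).+1 else 0).
  case: j jn => [|j] jn; first by rewrite mulr0.
  by rewrite ltnW // subnSK.
set k := (n - j)%N.
have e_qw : ann (qw k.+1 - (if j is j'.+1 then qw k.+1 else 0)).
  by rewrite /k; case: j jn {k} => [|j] jn; rewrite ?subrr // subr0 subn0.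
move: (if j is j'.+1 then _ else _) e_qw => y e_qw.
have -> : (-1) ^+ k.+1 * y - x * ((-1) ^+ k * qw k) - (-1) ^+ k.+1 * qv k.+1
        = (-1) ^+ k * ((qv k.+1 - (qw k.+1 + x * qw k)) + (qw k.+1 - y)).
  rewrite [x * (_ * _)]mulrA commr_sign exprSr -!mulrA !mulN1r -!mulrBr; congr (_ * _).
  by rewrite opprK opprD [qv k.+1 + _]addrA [RHS]addrACA subrK [LHS]addrC [in LHS](addrC (- y)).
by apply: annMl; apply: annD.
Qed.

End SignedStep.

Section Annihilator.
Variables (F : fieldType) (V : finType) (E : rel V) (lvl : V -> nat).
Hypothesis lvl_edge : forall v w, E v w -> lvl v = (lvl w).+1.
Local Notation A := {malg F[{fmonom (V * nat)%type}]}.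
Local Notation X := {malg F[seq (V * nat)]}.
Local Notation T := {malg F[{fmonom (Vp lvl)}]}.
Local Notation dot := (@dot F V E lvl).
Local Notation pcoef := (pcoef F lvl).
Local Notation qcoef := (qcoef F lvl).

Definition ann (u : A) : Prop := forall m, dot (bas m) u = 0.

Lemma annP u : ann u -> forall x, dot x u = 0.
Proof.
move=> au x; rewrite [x]malg_lextE lextE dotE linear_sum big1 // => m _.
by rewrite linearZ /= -dotE au scaler0.
Qed.

Lemma ann0 : ann 0.
Proof. by move=> m; rewrite linear0. Qed.

Lemma annD u v : ann u -> ann v -> ann (u + v).
Proof. by move=> au av m; rewrite linearD /= au av addr0. Qed.

Lemma annN u : ann u -> ann (- u).
Proof. by move=> au m; rewrite linearN /= au oppr0. Qed.

Lemma annB u v : ann u -> ann v -> ann (u - v).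
Proof. by move=> au av; apply: annD => //; apply: annN. Qed.

Lemma annMl u v : ann v -> ann (u * v).
Proof. by move=> av m; rewrite dotM annP. Qed.

Lemma annMr u v : ann u -> ann (u * v).
Proof. by move=> au m; rewrite dotM au dotE linear0. Qed.

Lemma ann_sum (I : Type) (r : seq I) (P : pred I) (f : I -> A) :
  (forall i, P i -> ann (f i)) -> ann (\sum_(i <- r | P i) f i).
Proof. by move=> af; elim/big_ind: _ => //; [apply: ann0 | apply: annD]. Qed.

Lemma ann_qcoef u j v n : reach E j u v -> (j < n)%N -> ann (qcoef u v n).
Proof. by move=> uv jn m; apply: (dot_qcoef_eq0 F lvl_edge m uv jn). Qed.

Lemma qcoef1 v w : qcoef v w 1%N = pcoef v 1%N - pcoef w 1%N.
Proof. by rewrite /qcoef rdivE big_ord1 rdiv0 pcoef0 mul1r subn0. Qed.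

(** Factor P_v P_l^-1 through P_w: along an edge the first factor P_v P_w^-1 acts as a polynomial of
    degree one. *)
Lemma ann_qcoef_edge v w l k : E v w ->
  ann (qcoef v l k.+1 - (qcoef w l k.+1 + (pcoef v 1%N - pcoef w 1%N) * qcoef w l k)).
Proof.
move=> vw; rewrite (qcoef_conv _ _ _ w) -qcoef1 conv_split2 ?qcoef0 //.
by apply: ann_sum => i _; apply: annMr; apply: ann_qcoef (reach1 vw) _.
Qed.

(** e(a,1) is the sum of the edges of a path from a to the bottom, which telescopes to a under (v,w)
    -> v - w. *)
Definition level_sym (a : Vp lvl) : V * nat := (val a, 1%N).
Local Notation iota_sym := (@msubst F (Vp lvl) (V * nat)%type level_sym).

Lemma iota_edge v w : E v w ->
  iota_sym (tel (edge_img F lvl (v, w))) = pcoef v 1%N - pcoef w 1%N.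
Proof.
move=> /lvl_edge vw; rewrite /edge_img [(v, w).1]/= [(v, w).2]/=.
have v0 : (0 < lvl v)%N by rewrite vw.
rewrite insubT pcoefE //; case: insubP => [b w0 bw|].
  rewrite tel_word2 linearB /=.
  rewrite !msubst_mon.
  rewrite /=.
  rewrite [pcoef w _]pcoefE ?w0 //.
  rewrite /level_sym.
  rewrite bw.
  by [].
rewrite -leqNgt => w0; rewrite pcoef_gt // subr0.
by rewrite -[[:: _]]/(tword F _) tel_word msubst_mon.
Qed.

Lemma reach_path v s : path E v s -> reach E (size s) v (last v s).
Proof.
elim: s v => [|w s IH] v //= /andP[vw /IH ws].
by apply/existsP; exists w; rewrite vw.
Qed.

(* Modulo the annihilator, the product along an edge path from [v] to [l]
   is [P_v P_l^-1]; in particular it only depends on [v] and [l]. *)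
Lemma ann_prod_lin v s j : path E v s ->
  ann (iota_sym (tel (nth (tzero F lvl)
         (prod_lin [seq edge_img F lvl e | e <- path_edges v s]) j))
       - signed (size s) (qcoef v (last v s)) j).
Proof.
elim: s v j => [|w s IH] v j.
  case: j => [|j] _ /=; rewrite /signed.
    by rewrite tel1 msubst1 qcoef0 expr0 mulr1 subrr; apply: ann0.
  by rewrite nth_nil tel0 linear0 subr0; apply: ann0.
case/andP => vw ws; rewrite [path_edges _ _]/= [map _ _]/= [last _ _]/= [size _]/=.
pose c i := iota_sym (tel (nth (tzero F lvl)
  (prod_lin [seq edge_img F lvl e | e <- path_edges w s]) i)).
have <- : (if j is j'.+1 then c j' else 0) - (pcoef v 1%N - pcoef w 1%N) * c j =
  iota_sym (tel (nth (tzero F lvl)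
    (prod_lin (edge_img F lvl (v, w) :: [seq edge_img F lvl e | e <- path_edges w s])) j)).
  rewrite tel_nth_prod_lin linearB /= msubstM iota_edge //; congr (_ - _).
  by case: j => //; rewrite linear0.
apply: (@signed_step _ ann ann0 annD annMl _ c (qcoef v (last w s)) (qcoef w (last w s))).
- exact: qcoef0.
- exact: qcoef0.
- exact: ann_qcoef (reach_path ws) _.
- by move=> k; apply: ann_qcoef_edge.
by move=> i; apply: IH.
Qed.

Lemma ann_RV_gen x : RV_gen E x -> ann (iota_sym (tel x)).
Proof.
move=> [v [s1 [s2 [j [p1 p2 eq_last ->]]]]].
have eq_size : size s1 = size s2.
  have := reach_lvl lvl_edge (reach_path p1); rewrite eq_last.
  by rewrite (reach_lvl lvl_edge (reach_path p2)) => /addIn.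
have word_cong a b c : ann (a - c) -> ann (b - c) -> ann (a - b).
  by move=> ac bc; have := annB ac bc; rewrite opprB addrA subrK.
rewrite telB linearB /=; apply: word_cong (ann_prod_lin j p1) _.
rewrite eq_last eq_size; exact: ann_prod_lin.
Qed.

Lemma ann_RV u : idl (RV_gen E (lvl := lvl)) u -> ann (iota_sym u).
Proof.
move=> [l [genl ->]]; elim: l genl => [|t l IH] genl.
  by rewrite big_nil linear0; apply: ann0.
rewrite big_cons linearD /= !msubstM; apply: annD.
  by apply: annMr; apply: annMl; apply: ann_RV_gen; apply: genl; left.
by apply: IH => t' ?; apply: genl; right.
Qed.

End Annihilator.

(** * Leading forms of relations of A(Gamma) *)

Section NormalForms.
Variables (F : fieldType) (V : finType) (E : rel V) (lvl : V -> nat).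
Hypothesis lvl_edge : forall v w, E v w -> lvl v = (lvl w).+1.
Hypothesis out_edge : forall v, (0 < lvl v)%N -> exists w, E v w.
Local Notation Vp := (Vp lvl).
Local Notation A := {malg F[{fmonom (V * nat)%type}]}.
Local Notation X := {malg F[seq (V * nat)]}.
Local Notation T := {malg F[{fmonom Vp}]}.
Local Notation dot := (@dot F V E lvl).
Local Notation pcoef := (pcoef F lvl).
Local Notation reach := (reach E).
Local Notation normal := (normal E lvl).
Local Notation covered := (covered E).
Local Notation level_sym := (@level_sym V lvl).
Local Notation wt := (wwt (swt lvl)).
Local Notation xbelow := (below (@wwt (V * nat)%type (swt lvl))).

(** The leading term of e(v,1) acting on a normal word: [v] either prolongs the last symbol or
    starts a new one. *)
Definition nfstep (m : seq (V * nat)) (v : V) : seq (V * nat) :=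
  if m is (u, j) :: m' then
    if reach j u v then (u, j.+1) :: m' else (v, 1%N) :: m
  else [:: (v, 1%N)].

Lemma nfstep_uncovered m v : ~~ covered m v -> nfstep m v = (v, 1%N) :: m.
Proof. by case: m => [|[u j] m] //= /negbTE->. Qed.

Lemma nfstep_normal m v : normal m -> (0 < lvl v)%N -> normal (nfstep m v).
Proof.
move=> nm v0; have [|ncov] := boolP (covered m v); last first.
  by rewrite nfstep_uncovered //= v0 ncov.
case: m nm => // -[u j] m /= /and3P[_ ncov nm] uv; rewrite uv /= ncov nm.
by rewrite (reach_lvl lvl_edge uv) !andbT -addn1 leq_add2l.
Qed.

Lemma swt1 v : swt lvl (v, 1%N) = lvl v.
Proof. by rewrite /swt big_ord1 subn0. Qed.

Lemma wt_nfstep m v : wt (nfstep m v) = (wt m + lvl v)%N.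
Proof.
have [|ncov] := boolP (covered m v); last first.
  by rewrite nfstep_uncovered // wwt_cons swt1 addnC.
case: m => // -[u j] m /= uv; rewrite uv !wwt_cons -addn1.
by rewrite (swt_reach _ (reach_lvl lvl_edge uv)) swt1 addnAC.
Qed.

Lemma dot_below n n' x (u : A) : xbelow n x -> wbounded (swt lvl) n' u ->
  xbelow (n + n') (dot x u).
Proof.
move=> /belowP[->|[m -> bx]] bu; first by rewrite dotE linear0; apply: below0.
by apply: bounded_below (dot_bounded lvl_edge bx bu).
Qed.

Lemma dot_nfstep m v : normal m -> (0 < lvl v)%N ->
  xbelow (wt m + lvl v) (dot (bas m) (mon F [:: (v, 1%N)]) - bas (nfstep m v)).
Proof.
move=> nm v0; have [|ncov] := boolP (covered m v); last first.
  by rewrite nfstep_uncovered // (dot_append F lvl_edge) // subrr; apply: below0.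
case: m nm => // -[u j] m nm cov; have uv : reach j u v := cov; rewrite {cov}.
rewrite (dot_cover F lvl_edge _ nm uv) /nfstep uv addn1 addrAC subrr add0r wwt_cons.
have lvl_uv := reach_lvl lvl_edge uv.
have bm : bounded wt (wt m) (bas m : X) by apply: bounded_bas.
apply: below_sum => l _; have lj := ltn_ord l.
have lt := swt_split_lt lvl_uv lj.
have bq := qcoef_bounded F lvl_uv (ltnW lj).
apply: belowB.
  apply: (@bounded_below _ _ _ (wt m + (swt lvl (u, l : nat) + swt lvl (v, j - l)%N) + swt lvl (v, 1%N))%N).
    by rewrite swt1; move: lt => /=; lia.
  apply: (dot_bounded lvl_edge).
    by apply: (dot_bounded lvl_edge bm); apply: wboundedM bq _; apply: pcoef_bounded.
  by apply: wbounded_mon; rewrite wwt_cons wwt_nil addn0.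
apply: (@bounded_below _ _ _ (wt m + (swt lvl (u, l : nat) + swt lvl (v, j - l + 1)%N))%N).
  by move: lt (swt_subadd lvl v (j - l) 1); rewrite swt1 => /=; lia.
by apply: (dot_bounded lvl_edge bm); apply: wboundedM bq _; apply: pcoef_bounded.
Qed.

Definition nf (m : seq (V * nat)) (w : seq Vp) := foldl (fun m a => nfstep m (val a)) m w.

Lemma wt_level_sym (w : seq Vp) : wt [seq level_sym a | a <- w] = weight w.
Proof. by rewrite /wwt big_map /weight; apply: eq_bigr => a _; rewrite swt1. Qed.

Lemma wt_nf m w : wt (nf m w) = (wt m + weight w)%N.
Proof.
elim: w m => [|a w IH] m /=; first by rewrite /weight big_nil addn0.
by rewrite IH wt_nfstep /weight big_cons addnA.
Qed.

Lemma dot_nf m w : normal m ->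
  xbelow (wt m + weight w)
    (dot (bas m) (mon F [seq level_sym a | a <- w]) - bas (nf m w)).
Proof.
elim: w m => [|a w IH] m nm /=; first by rewrite mon_nil dot1 subrr; apply: below0.
have -> : mon F (level_sym a :: [seq level_sym b | b <- w]) =
    mon F [:: (val a, 1%N)] * mon F [seq level_sym b | b <- w] by rewrite monM.
rewrite dotM -[dot (bas m) _](subrK (bas (nfstep m (val a)))).
rewrite dotE linearD /= -!dotE -addrA.
have a0 := valP a; have -> : weight (a :: w) = (lvl (val a) + weight w)%N.
  by rewrite /weight big_cons.
rewrite addnA; apply: belowD.
  apply: dot_below (dot_nfstep nm a0) _.
  by apply: wbounded_mon; rewrite wt_level_sym.
by rewrite -wt_nfstep; apply: IH; apply: nfstep_normal.
Qed.

(** A relation acts as zero on the empty word, and its action differs from the normal form map only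
    in weights below [i], by [dot_nf]. *)
Lemma RV_nf_coef u i k : idl (RV_gen E (lvl := lvl)) u ->
  bounded (fun w : {fmonom Vp} => weight w) i u -> wt k = i ->
  (lext (fun w : {fmonom Vp} => bas (nf [::] w) : X) u)@_k = 0.
Proof.
move=> /(ann_RV lvl_edge)/(_ [::]) au bu ki.
set L := lext _ u; have -> : L = - (dot (bas [::]) (msubst level_sym u) - L).
  by rewrite au sub0r opprK.
rewrite mcoeffN /msubst linear_lext lextB lextE.
rewrite raddf_sum big_seq big1 ?oppr0 // => w; rewrite -mcoeff_neq0 => nzw.
rewrite /= mcoeffZ; have -> := @dot_nf [::] w isT k; first by rewrite mulr0.
by rewrite wwt_nil add0n ki; apply: bounded_mem bu nzw.
Qed.

(** A chosen successor inside V_+; in a layered graph the default value occurs only at level one. *)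
Definition next_vertex (a : Vp) : Vp := if [pick b | Ep E a b] is Some b then b else a.

Definition segment (s : V * nat) : seq Vp :=
  if insub s.1 is Some a then traject next_vertex a s.2 else [::].

Definition expand (m : seq (V * nat)) : seq Vp := flatten [seq segment s | s <- rev m].

Lemma expand_cons s m : expand (s :: m) = expand m ++ segment s.
Proof. by rewrite /expand rev_cons map_rcons flatten_rcons. Qed.

Lemma Ep_next (a : Vp) : (1 < lvl (val a))%N -> Ep E a (next_vertex a).
Proof.
move=> a1; rewrite /next_vertex; case: pickP => // none.
have [w aw] := out_edge (valP a).
have w0 : (0 < lvl w)%N by move: a1; rewrite (lvl_edge aw).
by have := none (Sub w w0 : Vp); rewrite /Ep SubK aw.
Qed.

Lemma path_traject k (a : Vp) : (k < lvl (val a))%N ->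
  path (Ep E (lvl := lvl)) a (traject next_vertex (next_vertex a) k).
Proof.
elim: k a => //= k IH a lt; have aa := Ep_next (leq_ltn_trans (ltn0Sn k) lt).
by rewrite aa IH // -ltnS -(lvl_edge aa).
Qed.

Lemma reach_Ep j (a b : Vp) : reach j (val a) (val b) ->
  exists s, [/\ size s = j, path (Ep E (lvl := lvl)) a s & last a s = b].
Proof.
elim: j a => [|j IH] a /=; first by move/eqP/val_inj->; exists [::].
case/existsP => x /andP[ax xb].
have x0 : (0 < lvl x)%N by rewrite (reach_lvl lvl_edge xb) addn_gt0 (valP b) orbT.
have [|s [<- xs sb]] := IH (Sub x x0); first by rewrite SubK.
by exists (Sub x x0 :: s); rewrite /= {1}/Ep SubK ax.
Qed.

Local Notation idg := (idl (Rgr_gen E (lvl := lvl))).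

Definition word_cong (w w' : seq Vp) : Prop := idg (mon F w - mon F w').

Lemma cong_refl w : word_cong w w.
Proof. by rewrite /word_cong subrr; apply: idl0. Qed.

Lemma cong_trans w2 w1 w3 : word_cong w1 w2 -> word_cong w2 w3 -> word_cong w1 w3.
Proof. by move=> c12 c23; rewrite /word_cong -(subrK (mon F w2) (mon F w1)) -addrA; apply: idlD. Qed.

Lemma cong_cat a b w w' : word_cong w w' -> word_cong (a ++ w ++ b) (a ++ w' ++ b).
Proof.
rewrite /word_cong -!monM -mulrBr -mulrBl => c.
by apply: idlMl; apply: idlMr.
Qed.

Lemma cong_path (a : Vp) s s' : size s = size s' ->
  path (Ep E (lvl := lvl)) a s -> path (Ep E (lvl := lvl)) a s' ->
  word_cong (a :: s) (a :: s').
Proof.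
move=> eq_size ps ps'; rewrite /word_cong -!(tel_word F) -telB.
by apply: idl_gen; exists a, s, s'.
Qed.

(** In the covered case two path relations are used: the chosen segment of j vertices is rerouted so
    that [a] continues it, and the resulting path of j + 1 vertices is exchanged for the chosen
    one. *)
Lemma cong_nfstep m (a : Vp) : normal m ->
  word_cong (expand m ++ [:: a]) (expand (nfstep m (val a))).
Proof.
move=> nm; have [|ncov] := boolP (covered m (val a)); last first.
  rewrite nfstep_uncovered // expand_cons /segment /= valK; exact: cong_refl.
case: m nm => // -[u j] m /= /and3P[/andP[j0 ju] _ _] uv; rewrite uv !expand_cons.
have u0 : (0 < lvl u)%N by apply: leq_trans ju.
rewrite /segment /= insubT; set b : Vp := Sub u u0.
have bu : val b = u by rewrite SubK.
have [|s [size_s ps last_s]] := @reach_Ep j b a; first by rewrite bu.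
have ltj : (j < lvl (val b))%N.
  by rewrite bu (reach_lvl lvl_edge uv) -addn1 leq_add2l (valP a).
case: j j0 ju uv size_s ltj => // j _ _ _ size_s ltj.
case/lastP: s ps last_s size_s => // s c; rewrite rcons_path last_rcons size_rcons.
move=> /andP[ps sc] ca [size_s]; rewrite {}ca in sc *.
apply: (@cong_trans (expand m ++ (b :: s) ++ [:: a])).
  rewrite -catA; apply: cong_cat; rewrite /=.
  by apply: cong_path => //; [rewrite size_traject | apply: path_traject; apply: ltnW].
have H : word_cong (b :: rcons s a) (b :: traject next_vertex (next_vertex b) j.+1).
  apply: cong_path; first by rewrite size_rcons size_traject size_s.
    by rewrite rcons_path ps.
  exact: path_traject.
by have := cong_cat (expand m) [::] H; rewrite !cats0 -cats1.
Qed.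

Lemma cong_nf m w : normal m -> word_cong (expand m ++ w) (expand (nf m w)).
Proof.
elim: w m => [|a w IH] m nm /=; first by rewrite cats0; apply: cong_refl.
apply: (cong_trans (w2 := expand (nfstep m (val a)) ++ w)).
  have := cong_cat [::] w (cong_nfstep a nm); by rewrite /= -catA.
by apply: IH; apply: nfstep_normal (valP a).
Qed.

Definition top_part i : T -> T :=
  lext (fun w : {fmonom Vp} => if weight w == i then bas w else 0).

HB.instance Definition _ i := GRing.Linear.copy (top_part i)
  (lext (fun w : {fmonom Vp} => if weight w == i then bas w else 0)).

(* Leading components of relations of [A(Gamma)] are relations of the graded
   algebra: the normal form map kills [R_V] and is, in top weight, the
   reduction modulo [R_gr] of words to normal words. *)
Lemma top_RV u i : idl (RV_gen E (lvl := lvl)) u ->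
  bounded (fun w : {fmonom Vp} => weight w) i u -> idg (top_part i u).
Proof.
(* [D] turns symbol words of weight [i] back into vertex words and discards all others, so it kills
   the normal form of [u]. *)
move=> Ru bu; pose D : X -> T := lext (fun k => if wt k == i then mon F (expand k) else 0).
pose L := lext (fun w : {fmonom Vp} => bas (nf [::] w) : X) u.
have DL0 : D L = 0.
  apply: lext_eq0 => k nz; case: (wt k =P i) => // ki.
  by case/eqP: nz; apply: RV_nf_coef Ru bu ki.
have DL : D L = lext (fun w : {fmonom Vp} => D (bas (nf [::] w))) u by rewrite [LHS](linear_lext (lext _)).
have -> : top_part i u = lext (fun w : {fmonom Vp} =>
    (if weight w == i then bas w else 0) - D (bas (nf [::] w))) u.
  by rewrite -lextB -DL DL0 subr0.
rewrite lextE.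
apply: idl_sum => w _ _.
apply: idlZ; rewrite /D lext_bas wt_nf wwt_nil add0n.
case: eqP => _; last by rewrite subr0; apply: idl0.
rewrite -{1}[w]fmK; exact: (@cong_nf [::] w isT).
Qed.

End NormalForms.

(** * Homogeneous components for the weight grading *)

Section TopComponents.
Variables (F : fieldType) (V : finType) (E : rel V) (lvl : V -> nat).
Local Notation Vp := (Vp lvl).
Local Notation T := {malg F[{fmonom Vp}]}.
Local Notation vwt := (fun a : Vp => lvl (val a)).
Local Notation tbounded := (@wbounded F Vp vwt).
Local Notation tbelow := (@below F {fmonom Vp} (fun w : {fmonom Vp} => wwt vwt w)).
Local Notation top_part := (@top_part F V lvl).

Lemma mcoeff_top i (u : T) (w : {fmonom Vp}) :
  (top_part i u)@_w = if weight w == i then u@_w else 0.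
Proof.
have uE : u@_w = \sum_(k <- msupp u) u@_k * (k == w)%:R.
  rewrite {1}[u]malg_lextE lextE raddf_sum; apply: eq_bigr => k _.
  by rewrite /= mcoeffZ mcoeff_bas.
rewrite /top_part lextE raddf_sum /=; case: ifP => wi.
  rewrite uE; apply: eq_bigr => k _; rewrite mcoeffZ; case: ifP => ki.
    by rewrite mcoeff_bas.
  by rewrite mcoeff0; case: (k =P w) => // kw; rewrite kw wi in ki.
rewrite big1 // => k _; rewrite mcoeffZ; case: ifP => ki; last by rewrite mcoeff0 mulr0.
rewrite mcoeff_bas; case: (k =P w) => [kw|_]; last by rewrite mulr0.
by rewrite kw wi in ki.
Qed.

Lemma topD i u v : top_part i (u + v) = top_part i u + top_part i v.
Proof. exact: linearD. Qed.

Lemma topB i u v : top_part i (u - v) = top_part i u - top_part i v.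
Proof. exact: linearB. Qed.

Lemma top_mon i w : top_part i (mon F w) = if weight w == i then mon F w else 0.
Proof. exact: lext_bas. Qed.

Lemma top_below i u : tbelow i u -> top_part i u = 0.
Proof.
by move=> bu; apply/malgP => w; rewrite mcoeff_top mcoeff0; case: eqP => // wi; rewrite bu // -wi.
Qed.

Lemma below_top i u : tbounded i u -> tbelow i (u - top_part i u).
Proof.
move=> bu w; rewrite leq_eqVlt mcoeffB mcoeff_top => /orP[/eqP wi|lt].
  by rewrite wi eqxx subrr.
by rewrite bu // if_same subrr.
Qed.

Lemma bounded_top i u : tbounded i (top_part i u).
Proof. by move=> w lt; rewrite mcoeff_top; case: eqP => // wi; move: lt; rewrite -wi ltnn. Qed.

Lemma top_top i j u : top_part i (top_part j u) = if i == j then top_part j u else 0.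
Proof.
apply/malgP => w; rewrite 2!mcoeff_top; have [->|ij] := eqVneq i j.
  by rewrite mcoeff_top; case: eqP.
by rewrite mcoeff0; case: (weight w =P i) => // ->; rewrite (negbTE ij).
Qed.

Lemma top_homM i j (u v : T) : top_part (i + j) (top_part i u * top_part j v) = top_part i u * top_part j v.
Proof.
rewrite [top_part i u * _]lext_mul linear_sum; apply: eq_bigr => w _ /=.
rewrite linear_sum; apply: eq_bigr => w' _; rewrite linearZ /=; congr (_ *: _).
case: eqP => [wi|_]; last by rewrite mul0r linear0.
case: eqP => [wj|_]; last by rewrite mulr0 linear0.
rewrite -[w]fmK -[w']fmK monM top_mon.
by rewrite /weight big_cat /= -/(weight w) -/(weight w') wi wj eqxx.
Qed.

(** Replacing each factor in turn by its leading part changes the product only in weights below i +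
    j. *)
Lemma topM i j (u v : T) : tbounded i u -> tbounded j v ->
  top_part (i + j) (u * v) = top_part i u * top_part j v.
Proof.
move=> bu bv.
have z1 : top_part (i + j) ((u - top_part i u) * v) = 0.
  by apply: top_below; apply: below_mul bv; apply: below_top.
have z2 : top_part (i + j) (top_part i u * (v - top_part j v)) = 0.
  by apply: top_below; apply: mul_below; [apply: bounded_top | apply: below_top].
apply: etrans (congr1 (top_part (i + j)) (mul_split u (top_part i u) v (top_part j v))) _.
exact: (additive_split (@topD (i + j)) z1 z2 (top_homM i j u v)).
Qed.

Lemma sum_top n u : (forall w : {fmonom Vp}, u@_w != 0 -> (weight w < n)%N) ->
  \sum_(i < n) top_part i u = u.
Proof.
move=> bu; apply/malgP => w; rewrite raddf_sum /=.
under eq_bigr do rewrite mcoeff_top.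
have [->|nz] := eqVneq u@_w 0; first by rewrite big1 // => i _; rewrite if_same.
rewrite (bigD1 (Ordinal (bu w nz))) //= eqxx big1 ?addr0 // => i /eqP/val_eqP /= ne.
by rewrite eq_sym (negbTE ne).
Qed.

End TopComponents.

(** * Relations of the graded algebra as leading forms *)

Section LeadingTerms.
Variables (F : fieldType) (V : finType) (E : rel V) (lvl : V -> nat) (star : V).
Hypothesis lvl_edge : forall v w, E v w -> lvl v = (lvl w).+1.
Hypothesis lvl0 : forall v, lvl v = 0%N <-> v = star.
Hypothesis out_edge : forall v, (0 < lvl v)%N -> exists w, E v w.
Local Notation Vp := (Vp lvl).
Local Notation T := {malg F[{fmonom Vp}]}.
Local Notation vwt := (fun a : Vp => lvl (val a)).
Local Notation tbounded := (@wbounded F Vp vwt).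
Local Notation tbelow := (@below F {fmonom Vp} (fun w : {fmonom Vp} => wwt vwt w)).
Local Notation top_part := (@top_part F V lvl).
Local Notation pathp := (path (Ep E (lvl := lvl))).
Local Notation plus := (pmap (insub : V -> option Vp)).
Local Notation swt := (swt lvl).
Local Notation pcoefs p := (fun v i => tel (nth (tzero F lvl)
  (prod_lin [seq edge_img F lvl e | e <- path_edges v p]) i)).

Lemma path_to_star v : exists2 t, path E v t & last v t = star.
Proof.
have [n] := ubnP (lvl v); elim: n v => // n IH v; rewrite ltnS => le_v.
case: (posnP (lvl v)) => [/lvl0->|v0]; first by exists [::].
have [w vw] := out_edge v0; have [|t wt tw] := IH w.
  by rewrite -ltnS -(lvl_edge vw).
by exists (w :: t); rewrite //= vw.
Qed.

Lemma size_path_to_star v p : path E v p -> last v p = star -> size p = lvl v.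
Proof.
by move=> /reach_path/(reach_lvl lvl_edge)-> ->; rewrite (proj2 (lvl0 _) (erefl star)) addn0.
Qed.

Lemma swtS v w k : E v w -> swt (v, k.+1) = (lvl v + swt (w, k))%N.
Proof.
move=> vw; rewrite -add1n (swt_reach _ (v := w)) ?swt1 //.
by rewrite (lvl_edge vw).
Qed.

Lemma swt_edge_lt v w k : E v w -> (0 < k)%N -> (swt (w, k) < swt (v, k))%N.
Proof.
case: k => // k vw _; rewrite (swtS _ vw).
apply: leq_ltn_trans (swt_subadd lvl w 1 k) _.
by rewrite swt1 ltn_add2r (lvl_edge vw).
Qed.

Lemma weight_take_path v p k : path E v p -> last v p = star -> (k <= size p)%N ->
  weight (take k (plus (v :: p))) = swt (v, k).
Proof.
elim: k v p => [|k IH] v p; first by rewrite take0 /weight big_nil swt0.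
case: p => // w p /andP[vw wp] lst le_k.
have v0 : (0 < lvl v)%N by rewrite (lvl_edge vw).
have -> : plus (v :: w :: p) = Sub v v0 :: plus (w :: p) by rewrite /= (insubT (fun v => 0 < lvl v)%N v0).
rewrite take_cons /weight big_cons SubK (swtS _ vw); congr addn.
exact: IH.
Qed.

(* [plus (v :: p)] lists the vertices of the path other than [star]. *)
Lemma lead_prod_lin v p k : path E v p -> last v p = star -> (k <= size p)%N ->
  tbelow (swt (v, k))
    (pcoefs p v (size p - k)%N - (-1) ^+ k *: mon F (take k (plus (v :: p)))).
Proof.
elim: p v k => [|w p IH] v k.
  move=> _ _ /=; rewrite leqn0 => /eqP->.
  by rewrite /= tel1 take0 mon_nil expr0 scale1r subrr; apply: below0.
case/andP => vw wp lst le_k; pose c i := pcoefs p w i.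
have v0 : (0 < lvl v)%N by rewrite (lvl_edge vw).
pose a : Vp := Sub v v0.
have plusE : plus (v :: w :: p) = a :: plus (w :: p).
  by rewrite /= (insubT (fun v => 0 < lvl v)%N v0).
have {}IH i : (i <= size p)%N -> tbelow (swt (w, i))
    (c (size p - i)%N - (-1) ^+ i *: mon F (take i (plus (w :: p)))) := IH w i wp lst.
have bc i : (i <= size p)%N -> tbounded (swt (w, i)) (c (size p - i)%N).
  move=> le_i; rewrite -[c _](subrK ((-1) ^+ i *: mon F (take i (plus (w :: p))))).
  apply: boundedD; first exact: below_bounded (IH i le_i).
  by apply: boundedZ; apply: wbounded_mon; rewrite -[wwt _ _]/(weight _) weight_take_path.
(* [y] is the image of [w], or 0 if [w] is the bottom; either way it is lighter than [a]. *)
have [y by_ eE] : exists2 y, tbounded (lvl w) y &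
    tel (edge_img F lvl (v, w)) = mon F [:: a] - y.
  rewrite /edge_img [(v, w).1]/= [(v, w).2]/= insubT; case: insubP => [b b0 bw|_].
    exists (mon F [:: b]); last by rewrite tel_word2.
    by apply: wbounded_mon; rewrite wwt_cons wwt_nil addn0 bw.
  by exists 0; [apply: bounded0 | rewrite subr0 -tel_word].
have -> : pcoefs (w :: p) v (size (w :: p) - k)%N =
   (if (size (w :: p) - k)%N is j'.+1 then c j' else 0)
   - (mon F [:: a] - y) * c (size (w :: p) - k)%N.
  by rewrite -eE; apply: tel_nth_prod_lin.
rewrite plusE [size _]/=; case: k le_k => [|k] le_k.
  (* For k = 0 the index is one past the degree of the product along [p], so the default value 0 is
     read; the leading 1 comes from the shifted coefficient. *)
  have -> : c ((size p).+1 - 0)%N = 0.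
    rewrite /c nth_default ?tel0 // size_prod_lin size_map size_zip /=.
    by rewrite (minn_idPr (leqnSn _)).
  rewrite mulr0 subr0 take0.
  by have := IH 0%N isT; rewrite subn0 take0 !swt0.
rewrite subSS take_cons; set W := take k _.
have -> : mon F (a :: W) = mon F [:: a] * mon F W by rewrite monM.
set cj := c (size p - k)%N; set rest := (if _ is _.+1 then _ else _).
(* Only [a] times the leading word of [cj] has full weight; the three remaining contributions are
   strictly lighter. *)
have -> : rest - (mon F [:: a] - y) * cj - (-1) ^+ k.+1 *: (mon F [:: a] * mon F W) =
    rest + (y * cj - mon F [:: a] * (cj - (-1) ^+ k *: mon F W)).
  rewrite mulrBl opprB mulrBr malg_scaleAr opprB exprS mulN1r scaleNr opprK -addrA.
  by congr (_ + _); rewrite -addrA; congr (_ + _); rewrite addrC.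
have ba : tbounded (lvl v) (mon F [:: a]).
  by apply: wbounded_mon; rewrite wwt_cons wwt_nil addn0.
apply: belowD.
  rewrite /rest; case E' : (size p - k)%N => [|j]; first exact: below0.
  have le_k' : (k.+1 <= size p)%N by lia.
  have -> : j = (size p - k.+1)%N by lia.
  by apply: bounded_below (bc _ le_k'); apply: swt_edge_lt vw _.
rewrite (swtS _ vw); apply: belowB.
  apply: bounded_below (wboundedM by_ (bc _ _)) => //.
  by rewrite ltn_add2r (lvl_edge vw).
by apply: mul_below ba _; apply: IH.
Qed.

Lemma extend_to_star (a : Vp) s : pathp a s ->
  exists p, [/\ path E (val a) p, last (val a) p = star, size p = lvl (val a),
    ((size s).+1 <= size p)%N & take (size s).+1 (plus (val a :: p)) = a :: s].
Proof.
move=> ps; have [t pt lt] := path_to_star (val (last a s)).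
have pm : path E (val a) [seq val b | b <- s] by rewrite path_map.
have pp : path E (val a) ([seq val b | b <- s] ++ t) by rewrite cat_path pm last_map.
have lp : last (val a) ([seq val b | b <- s] ++ t) = star by rewrite last_cat last_map.
exists ([seq val b | b <- s] ++ t); split=> //; first exact: size_path_to_star.
  rewrite (size_path_to_star pp lp).
  have := reach_path pm; rewrite size_map last_map => /(reach_lvl lvl_edge)->.
  by rewrite -addn1 leq_add2l (valP (last a s)).
rewrite -cat_cons -[val a :: _]/[seq val b | b <- a :: s] pmap_cat pmap_insub_val.
by rewrite take_size_cat.
Qed.

Lemma weight_pathp (a : Vp) s : pathp a s -> weight (a :: s) = swt (val a, (size s).+1).
Proof.
by move=> /extend_to_star[p [pp lp _ le_k <-]]; apply: weight_take_path.
Qed.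

(** Both paths are continued to the bottom. Their coefficients at index |a| - k differ by a
    generator of R_V and have the two words, up to the same sign, as leading forms. *)
Lemma lead_Rgr_gen (a : Vp) s1 s2 : size s1 = size s2 -> pathp a s1 -> pathp a s2 ->
  exists y r, [/\ tbelow (swt (val a, (size s1).+1)) y,
    idl (RV_gen E (lvl := lvl)) r & mon F (a :: s1) - mon F (a :: s2) = y + r].
Proof.
move=> eq_size ps1 ps2; set k := (size s1).+1.
have [p1 [pp1 l1 sz1 le1 t1]] := extend_to_star ps1.
have [p2 [pp2 l2 sz2 le2 t2]] := extend_to_star ps2.
have := lead_prod_lin pp2 l2 le2; have := lead_prod_lin pp1 l1 le1.
rewrite t1 t2 sz1 sz2 -eq_size -/k.
set c1 := tel _; set c2 := tel _ => L1 L2.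
have Rc : idl (RV_gen E (lvl := lvl)) (c1 - c2).
  rewrite /c1 /c2 -telB; apply: idl_gen.
  by exists (val a), p1, p2, (lvl (val a) - k)%N; rewrite l1 l2.
exists ((-1) ^+ k *: ((c2 - (-1) ^+ k *: mon F (a :: s2)) - (c1 - (-1) ^+ k *: mon F (a :: s1)))).
exists ((-1) ^+ k *: (c1 - c2)); split; last exact: (esym (signed_cancel k c1 c2 _ _)).
  by apply: belowZ; exact: (belowB L2 L1).
exact: (idlZ _ Rc).
Qed.

(** The two words of a generator have equal weight, so a component of the product is either the
    whole product or zero. *)
Lemma top_Rgr_word (g : Tel F lvl) wa wb i : Rgr_gen E g ->
  exists y r, [/\ tbelow i y, idl (RV_gen E (lvl := lvl)) r &
    top_part i (mon F wa * tel g * mon F wb) = y + r].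
Proof.
move=> [a [s1 [s2 [eq_size ps1 ps2 ->]]]].
have [y [r [by_ Rr yrE]]] := lead_Rgr_gen eq_size ps1 ps2.
have w1 := weight_pathp ps1; have w2 := weight_pathp ps2.
rewrite telB !tel_word.
pose d := (weight wa + weight (a :: s1) + weight wb)%N.
have topE : top_part i (mon F wa * (mon F (a :: s1) - mon F (a :: s2)) * mon F wb) =
    if d == i then mon F wa * (mon F (a :: s1) - mon F (a :: s2)) * mon F wb else 0.
  have wcat s : weight (wa ++ s ++ wb) = (weight wa + weight s + weight wb)%N.
    by rewrite /weight !big_cat /= addnA.
  rewrite mulrBr mulrBl !monM -!catA topB !top_mon !wcat w2 -eq_size -w1 -/d.
  by case: ifP => // _; rewrite subrr.
rewrite {}topE; case: eqP => [<-|_]; last first.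
  by exists 0, 0; split; [apply: below0 | apply: idl0 | rewrite addr0].
exists (mon F wa * y * mon F wb), (mon F wa * r * mon F wb); split.
- apply: below_mul; last exact: wbounded_mon.
  by rewrite w1; apply: mul_below => //; apply: wbounded_mon.
- by apply: idlMr; apply: idlMl.
by rewrite yrE mulrDr mulrDl.
Qed.

Lemma top_Rgr u i : idl (Rgr_gen E (lvl := lvl)) u ->
  exists y r, [/\ tbelow i y, idl (RV_gen E (lvl := lvl)) r & top_part i u = y + r].
Proof.
pose P (u' : T) := exists y r, [/\ tbelow i y, idl (RV_gen E (lvl := lvl)) r & u' = y + r].
have P0 : P 0 by exists 0, 0; split; [apply: below0 | apply: idl0 | rewrite addr0].
have PD u1 u2 : P u1 -> P u2 -> P (u1 + u2).
  move=> [y1 [r1 [b1 R1 ->]]] [y2 [r2 [b2 R2 ->]]]; exists (y1 + y2), (r1 + r2).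
  by split; [apply: belowD | apply: idlD | rewrite addrACA].
have PZ c u1 : P u1 -> P (c *: u1).
  move=> [y1 [r1 [b1 R1 ->]]]; exists (c *: y1), (c *: r1).
  by split; [apply: belowZ | apply: idlZ | rewrite scalerDr].
have Psum (J : Type) (s : seq J) (f : J -> T) : (forall j, P (f j)) -> P (\sum_(j <- s) f j).
  by move=> Pf; elim/big_ind: _.
move=> [l [Sl ->]]; rewrite -/(P _); elim: l Sl => [|t l IH] Sl.
  by rewrite big_nil linear0.
rewrite big_cons topD; apply: PD; last by apply: IH => t' ?; apply: Sl; right.
have gt : Rgr_gen E t.1.2 by apply: Sl; left.
rewrite tel_sandwich linear_sum; apply: (Psum _ _ _) => p.
rewrite /= linear_sum; apply: (Psum _ _ _) => q.
by rewrite /= linearZ; apply: PZ; apply: top_Rgr_word.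
Qed.

End LeadingTerms.

(** * The isomorphism *)

Section GradedIso.
Variables (F : fieldType) (V : finType) (E : rel V) (lvl : V -> nat) (star : V).
Hypothesis lvl_edge : forall v w, E v w -> lvl v = (lvl w).+1.
Hypothesis lvl0 : forall v, lvl v = 0%N <-> v = star.
Hypothesis out_edge : forall v, (0 < lvl v)%N -> exists w, E v w.
Local Notation Vp := (Vp lvl).
Local Notation T := {malg F[{fmonom Vp}]}.
Local Notation Tel := (Tel F lvl).
Local Notation vwt := (fun a : Vp => lvl (val a)).
Local Notation tbounded := (@wbounded F Vp vwt).
Local Notation tbelow := (@below F {fmonom Vp} (fun w : {fmonom Vp} => wwt vwt w)).
Local Notation top_part := (@top_part F V lvl).
Local Notation idg := (idl (Rgr_gen E (lvl := lvl))).
Local Notation idv := (idl (RV_gen E (lvl := lvl))).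

Definition component (a : seq Tel) i : T := tel (nth (tzero F lvl) a i).

Lemma comp_default a i : (size a <= i)%N -> component a i = 0.
Proof. by move=> le; rewrite /component nth_default // tel0. Qed.

Lemma inFP i (x : Tel) : inF i x <-> tbounded i (tel x).
Proof.
split=> [xi w lt|xi w lt]; last by rewrite -mcoeff_tel xi.
by rewrite -[w]fmK mcoeff_tel xi.
Qed.

Lemma inFltP i (x : Tel) : inFlt i x <-> tbelow i (tel x).
Proof.
split=> [xi w lt|xi w lt]; last by rewrite -mcoeff_tel xi.
by rewrite -[w]fmK mcoeff_tel xi.
Qed.

Lemma gr_validP a i : gr_valid a -> tbounded i (component a i).
Proof. by move=> /(_ i)/inFP. Qed.

Lemma RgrP (x : Tel) : Rgr E x <-> idg (tel x).
Proof. exact: in_idealP. Qed.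

Lemma gr_eqP a b : gr_eq E a b <-> forall i, exists y r,
  [/\ tbelow i y, idv r & component a i - component b i = y + r].
Proof.
split=> ab i; have := ab i.
  move=> [y [r [/inFltP by_ [/in_idealP Rr]]]] /teqP; rewrite telB telD => H.
  by exists (tel y), (tel r).
move=> [y [r [by_ Rr H]]]; have [y' y'E] := tel_surj y; have [r' r'E] := tel_surj r.
exists y', r'; split; first by apply/inFltP; rewrite y'E.
split; first by apply/in_idealP; rewrite r'E.
by apply/teqP; rewrite telB telD y'E r'E.
Qed.

Definition tel_part i (x : Tel) : Tel := [seq p <- x | weight p.2 == i].

Lemma tel_partE i x : tel (tel_part i x) = top_part i (tel x).
Proof.
rewrite !telE big_filter big_mkcond linear_sum; apply: eq_bigr => p _.
by rewrite /= linearZ /= top_mon; case: ifP => //; rewrite scaler0.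
Qed.

Definition symbol (a : seq Tel) : Tel :=
  tsum [seq tel_part i (nth (tzero F lvl) a i) | i <- iota 0 (size a)].

Lemma tel_symbol N a : (size a <= N)%N -> tel (symbol a) = \sum_(i < N) top_part i (component a i).
Proof.
move=> le_N; rewrite /symbol tel_sum big_map -[iota _ _]/(iota 0 (size a)).
rewrite -{1}[size a]subn0 -/(index_iota 0 (size a)).
rewrite (eq_bigr (fun i => top_part i (component a i))); last by move=> i _; rewrite tel_partE.
rewrite big_mkord (big_ord_widen _ (fun i => top_part i (component a i)) le_N) big_mkcond.
apply: eq_bigr => i _ /=; case: ltnP => // le_i.
by rewrite comp_default // linear0.
Qed.

(** Well-definedness is [top_RV] applied in each degree; injectivity is [top_Rgr], which reads off
    each homogeneous component of the difference of symbols. *)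
Lemma gr_eq_symbol a b : gr_valid a -> gr_valid b ->
  (gr_eq E a b <-> Rgr E (tsub (symbol a) (symbol b))).
Proof.
move=> va vb; rewrite gr_eqP RgrP telB.
have bd i : tbounded i (component a i - component b i).
  by apply: boundedB; apply: gr_validP.
have symB N : (size a + size b <= N)%N ->
    tel (symbol a) - tel (symbol b) = \sum_(i < N) top_part i (component a i - component b i).
  move=> le_N; rewrite !(@tel_symbol N) -?sumrB; try lia.
  by apply: eq_bigr => i _; rewrite topB.
split=> [ab|ab i].
  rewrite (symB _ (leqnn _)); apply: idl_sum => i _ _.
  have [y [r [by_ Rr H]]] := ab i.
  have rE : r = (component a i - component b i) - y by rewrite H addrC addKr.
  rewrite H topD (top_below by_) add0r.
  apply: (top_RV lvl_edge out_edge) => //; rewrite rE.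
  exact: (boundedB (@bd i) (below_bounded by_)).
have [y [r [by_ Rr H]]] := top_Rgr lvl_edge lvl0 out_edge i ab.
have topE : top_part i (tel (symbol a) - tel (symbol b)) = top_part i (component a i - component b i).
  (* The range is enlarged to contain the index [i], which may lie beyond both families. *)
  have lt_i : (i < size a + size b + i.+1)%N by lia.
  rewrite (symB (size a + size b + i.+1)%N); last by lia.
  rewrite linear_sum (bigD1 (Ordinal lt_i)) //= top_top eqxx big1 ?addr0 // => j /eqP/val_eqP /= ne.
  by rewrite top_top eq_sym (negbTE ne).
exists ((component a i - component b i - top_part i (component a i - component b i)) + y), r; split=> //.
  by apply: belowD => //; apply: below_top.
by rewrite -addrA -H topE subrK.
Qed.

Lemma symbol_surj x : exists a, gr_valid a /\ Rgr E (tsub (symbol a) x).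
Proof.
(* [n] exceeds the weight of every word of [x], so the components of weight below [n] sum to [x]. *)
pose n := (\max_(p <- x) weight p.2).+1.
pose a := mkseq (fun i => tel_part i x) n.
have compE i : component a i = if (i < n)%N then top_part i (tel x) else 0.
  case: ltnP => le_i; last by rewrite comp_default // size_mkseq.
  by rewrite /component nth_mkseq // tel_partE.
exists a; split.
  move=> i; apply/inFP; rewrite -[tel _]/(component a i) compE.
  by case: ifP => _; [apply: bounded_top | apply: bounded0].
have bx : tbounded n.-1 (tel x).
  rewrite telE big_seq; apply: bounded_sum => p px; apply: boundedZ.
  by apply: wbounded_mon; apply: (leq_bigmax_seq (F := fun p => weight p.2)) px _.
apply/RgrP; rewrite telB (@tel_symbol n) ?size_mkseq //.
rewrite (eq_bigr (fun i : 'I_n => top_part i (tel x))).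
  rewrite sum_top ?subrr; first exact: idl0.
  by move=> w nz; rewrite ltnS; apply: bounded_mem bx nz.
by move=> i _; rewrite compE ltn_ord top_top eqxx.
Qed.

Lemma Rgr_tel_eq (x y : Tel) : tel x = tel y -> Rgr E (tsub x y).
Proof. by move=> xy; apply/RgrP; rewrite telB xy subrr; apply: idl0. Qed.

Lemma comp_add a b i : component (gr_add a b) i = component a i + component b i.
Proof.
have [lt|le] := ltnP i (maxn (size a) (size b)).
  by rewrite /component nth_mkseq // telD.
move: (le); rewrite geq_max => /andP[la lb].
by rewrite !comp_default ?addr0 // size_mkseq.
Qed.

Lemma comp_scale c a i : component (gr_scale c a) i = c *: component a i.
Proof.
have [lt|le] := ltnP i (size a); first by rewrite /component (nth_map (tzero F lvl)) // telZ.
by rewrite !comp_default ?scaler0 // size_map.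
Qed.

Lemma comp_mul a b k : component (gr_mul a b) k = \sum_(i < k.+1) component a i * component b (k - i)%N.
Proof.
have [lt|le] := ltnP k (size a + size b).
  rewrite /component nth_mkseq // tel_sum big_map -[iota 0 _]/(index_iota 0 k.+1) big_mkord.
  by apply: eq_bigr => i _; rewrite telM.
rewrite comp_default ?size_mkseq // big1 // => i _.
have [la|la] := leqP (size a) i; first by rewrite comp_default // mul0r.
by rewrite (@comp_default b) ?mulr0 //; lia.
Qed.

Lemma symbol_mul a b : gr_valid a -> gr_valid b ->
  tel (symbol (gr_mul a b)) = tel (symbol a) * tel (symbol b).
Proof.
move=> va vb; rewrite (@tel_symbol (size a + size b)) ?size_mkseq //.
rewrite (tel_symbol (leqnn (size a))) (tel_symbol (leqnn (size b))).
rewrite -(sum_convolution (f := fun i => top_part i (component a i)) (g := fun i => top_part i (component b i))).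
- apply: eq_bigr => k _; rewrite comp_mul linear_sum; apply: eq_bigr => i _.
  have ik : (i <= k)%N by rewrite -ltnS.
  by rewrite /= -{1}(subnKC ik) topM //; apply: gr_validP.
- by move=> i le; rewrite comp_default // linear0.
by move=> i le; rewrite comp_default // linear0.
Qed.

Lemma symbol_one : tel (symbol (gr_one F lvl)) = 1.
Proof.
rewrite (@tel_symbol 1) // big_ord1 /component /= tel1 -mon_nil top_mon.
by rewrite /weight big_nil.
Qed.

Lemma gr_iso : gr_iso_Rgr F E lvl.
Proof.
exists symbol; split.
- exact: gr_eq_symbol.
- exact: symbol_surj.
- move=> a b _ _; apply: Rgr_tel_eq; rewrite telD.
  have sz : (size (gr_add a b) <= maxn (size a) (size b))%N by rewrite size_mkseq.
  rewrite (tel_symbol sz) (tel_symbol (leq_maxl (size a) (size b))).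
  rewrite (tel_symbol (leq_maxr (size a) (size b))) -big_split.
  by apply: eq_bigr => i _; rewrite comp_add topD.
- move=> c a _; apply: Rgr_tel_eq; rewrite telZ.
  have sz : (size (gr_scale c a) <= size a)%N by rewrite size_map.
  rewrite (tel_symbol sz) (tel_symbol (leqnn _)) scaler_sumr.
  by apply: eq_bigr => i _; rewrite comp_scale linearZ.
split; last by apply: Rgr_tel_eq; rewrite symbol_one tel1.
by move=> a b va vb; apply: Rgr_tel_eq; rewrite telM symbol_mul.
Qed.

End GradedIso.

Theorem mainTheorem4 (F : fieldType) (V : finType) (E : rel V)
    (lvl : V -> nat) (star : V) :
  layered E lvl star -> gr_iso_Rgr F E lvl.
Proof. by case=> lvl_edge lvl0 out_edge; apply: gr_iso lvl0 out_edge. Qed.
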